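(* Let $L>0$, and let $\bar\rho>0$, $\bar\theta>0$, $R>0$, $c_v>0$, $\kappa>0$, $\mu>0$, $\lambda$ be constants with $\lambda+\mu\ge0$. Let $H^1_m(0,L)=\{\rho\in H^1(0,L):\int_0^L\rho(x)\,dx=0\}$. Consider the control system \[ \begin{aligned} &\rho_t+\bar\rho\,u_x=0,\\ &u_t-\tfrac{\lambda+2\mu}{\bar\rho}u_{xx}+\tfrac{R\bar\theta}{\bar\rho}\rho_x+R\theta_x=g,\\ &\theta_t-\tfrac{\kappa}{\bar\rho c_v}\theta_{xx}+\tfrac{R\bar\theta}{c_v}u_x=h, \end{aligned} \quad\text{in }(0,L)\times(0,T), \] with $\rho(0)=\rho_0$, $u(0)=u_0$, $\theta(0)=\theta_0$ in $(0,L)$, and $u(0,t)=u(L,t)=0$, $\theta(0,t)=\theta(L,t)=0$ for $t>0$. Then for every $(\rho_0,u_0,\theta_0)\in H^1_m(0,L)\times L^2(0,L)\times L^2(0,L)$ and every $T>0$ there exist controls $g\in L^2(0,T;L^2(0,L))$ and $h\in L^2(0,T;L^2(0,L))$ such that the solution satisfies $(\rho,u,\theta)(x,T)=0$ for all $x\in(0,L)$.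
   Context: The controls act on the whole interval in the velocity and temperature equations; no control acts in the density equation. *)

(* Defs.v *)
From HB Require Import structures.
From mathcomp Require Import all_boot all_order all_algebra.
From mathcomp Require Import all_classical all_reals all_analysis.
Set Implicit Arguments. Unset Strict Implicit. Unset Printing Implicit Defensive.
Import Order.TTheory GRing.Theory Num.Theory.
Import numFieldNormedType.Exports.
Local Open Scope classical_set_scope.
Local Open Scope ring_scope.

Section Defs.
Variable R : realType.
Notation mu := (@lebesgue_measure R).
Definition cI (a b : R) : set R := `[a, b]%classic.

Definition sq_int_on (D : set R) (f : R -> R) : Prop :=
  measurable_fun D f /\ (\int[mu]_(x in D) ((f x) ^+ 2)%:E < +oo)%E.

(* f(x,t) belongs to L^2((0,L) x (0,T)) = L^2(0,T; L^2(0,L)) *)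
Definition L2rect (L T : R) (f : R -> R -> R) : Prop :=
  measurable_fun setT (fun p : R * R => f p.1 p.2) /\
  (\int[mu \x mu]_(p in cI 0 L `*` cI 0 T)
      ((f p.1 p.2) ^+ 2)%:E < +oo)%E.

Definition test_c1 (L : R) (phi : R -> R) : Prop :=
  (forall x, derivable phi x 1) /\ continuous (derive1 phi) /\
  exists a b : R, 0 < a /\ b < L /\ (forall x, x < a \/ b < x -> phi x = 0).

Definition H1 (L : R) (f : R -> R) : Prop :=
  sq_int_on `[0, L] f /\
  exists w : R -> R, sq_int_on `[0, L] w /\
    forall phi, test_c1 L phi ->
      Rintegral mu `[0, L] (fun x => f x * derive1 phi x)
      = - Rintegral mu `[0, L] (fun x => w x * phi x).

Definition H1m (L : R) (f : R -> R) : Prop :=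
  H1 L f /\ Rintegral mu `[0, L] f = 0.

Definition test_rho (psi : R -> R) : Prop :=
  (forall x, derivable psi x 1) /\ continuous (derive1 psi).

Definition test_dir (L : R) (phi : R -> R) : Prop :=
  (forall x, derivable phi x 1) /\ (forall x, derivable (derive1 phi) x 1) /\
  continuous (derive1 (derive1 phi)) /\ phi 0 = 0 /\ phi L = 0.

(* (rho,u,theta)(x,t) is a (weak) solution on [0,T] of the linearized
   compressible Navier-Stokes-Fourier system with controls g, h acting on
   the whole interval in the u- and theta- equations, Dirichlet boundary
   conditions on u and theta, and initial data (rho0,u0,theta0). *)
Definition is_solution (L T rhob thetab Rg cv kappa mu_ lambda : R)
  (rho0 u0 theta0 : R -> R) (g h : R -> R -> R) (rho u theta : R -> R -> R)
  : Prop :=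
  let nu := (lambda + 2 * mu_) / rhob in
  let a := Rg * thetab / rhob in
  let k := kappa / (rhob * cv) in
  let b := Rg * thetab / cv in
  [/\ [/\ L2rect L T rho, L2rect L T u & L2rect L T theta],
      (forall t, 0 <= t <= T ->
         [/\ sq_int_on `[0, L] (fun x => rho x t),
             sq_int_on `[0, L] (fun x => u x t) &
             sq_int_on `[0, L] (fun x => theta x t)]),
      (* rho_t + rhob u_x = 0 *)
      (forall t psi, 0 <= t <= T -> test_rho psi ->
         Rintegral mu `[0, L] (fun x => rho x t * psi x)
         - Rintegral mu `[0, L] (fun x => rho0 x * psi x)
         = Rintegral mu `[0, t] (fun s =>
             Rintegral mu `[0, L] (fun x => rhob * u x s * derive1 psi x))),
      (* u_t - nu u_xx + a rho_x + Rg theta_x = g *)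
      (forall t phi, 0 <= t <= T -> test_dir L phi ->
         Rintegral mu `[0, L] (fun x => u x t * phi x)
         - Rintegral mu `[0, L] (fun x => u0 x * phi x)
         = Rintegral mu `[0, t] (fun s =>
             Rintegral mu `[0, L] (fun x =>
               nu * u x s * derive1 (derive1 phi) x + a * rho x s * derive1 phi x
               + Rg * theta x s * derive1 phi x + g x s * phi x))) &
      (* theta_t - k theta_xx + b u_x = h *)
      (forall t phi, 0 <= t <= T -> test_dir L phi ->
         Rintegral mu `[0, L] (fun x => theta x t * phi x)
         - Rintegral mu `[0, L] (fun x => theta0 x * phi x)
         = Rintegral mu `[0, t] (fun s =>
             Rintegral mu `[0, L] (fun x =>
               k * theta x s * derive1 (derive1 phi) x + b * u x s * derive1 phi x
               + h x s * phi x)))].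

End Defs.

(* Main.v *)
Require Import Defs.
From HB Require Import structures.
From mathcomp Require Import all_boot all_order all_algebra.
From mathcomp Require Import all_classical all_reals all_analysis measurable_realfun.
From mathcomp Require Import ring lra.
Set Implicit Arguments. Unset Strict Implicit. Unset Printing Implicit Defensive.
Import Order.TTheory GRing.Theory Num.Theory.
Import numFieldNormedType.Exports.
Local Open Scope classical_set_scope.
Local Open Scope ring_scope.

(** The controls act on the whole interval, so they may be read off a prescribed
    trajectory, provided that the residuals of the velocity and temperature
    equations are square integrable. Since the initial data are only in L^2, near
    t = 0 the velocity has to follow the Dirichlet heat flow w of u0; this flow is
    subtracted linearly, and the ansatz is
      u = w(t) - (t / T) w(T) + gam(t) Z,
    where gam vanishes at 0 and T and has integral 1. The density is
    rho0 - rhob (int_0^t u)_x, hence it vanishes at time T exactly when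
    int_0^T u is the primitive of rho0 / rhob, and this determines Z. As
    nu w_xx = w_t, the time integral of w is in H^2, hence so is Z (this uses
    rho0 in H^1), and rho_x stays in L^2. The temperature is
    q(t) - (t / T) q(T) with q the heat flow of theta0; the energy estimate puts
    w_x and q_x in L^2, so that both controls are in L^2.
    The heat flow is given by its sine series, for which the weak formulation
    reduces to the expansion of C^2 test functions that vanish at the end points
    (pointwise convergence by Chernoff's telescoping argument). *)

(** The density equation has no control, so rho can be moved only through the time integral of u_x,
    and its mean is conserved because u vanishes at both ends; hence the zero mean. With u0 only in
    L^2, w_xx need not be square integrable up to t = 0, so it must never enter a control. This is
    why the flow runs with exactly the viscosity nu: w_t and nu w_xx cancel. The correction (t / T)
    w(T) costs only w(T) and w_xx(T), which are harmless since T > 0, whereas Z is differentiated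
    twice in g and has to be smoother than u0. The profile gam is 6 t (T - t) / T^3, a polynomial,
    so that its derivative and primitive are explicit. Derivatives of the trajectory are never taken
    pointwise: each is a function of its own, tied to the original by an identity between pairings
    with C^1 test functions. Dirichlet conditions are visible in the same way, as identities that
    also hold for test functions not vanishing at the ends. *)

(** * Square integrable functions over a general measure *)

Section SquareIntegral.
Context d (T : measurableType d) (R : realType).
Variables (m : {measure set T -> \bar R}) (D : set T).
Hypothesis mD : measurable D.
Implicit Types f g : T -> R.

(** The integral half of [sq_int_on], over an arbitrary measure so that it serves on the space-time
    rectangle too. *)
Definition fin_sq f := (\int[m]_(x in D) ((f x) ^+ 2)%:E < +oo)%E.

Lemma integrable_sq f : measurable_fun D f -> fin_sq f ->
  m.-integrable D (EFin \o (fun x => f x ^+ 2)).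
Proof.
move=> mf ff; apply/integrableP; split.
  by apply/measurable_EFinP; exact: measurable_funX.
rewrite (le_lt_trans _ ff)//; apply: ge0_le_integral => //=.
- by do 2 apply: measurableT_comp => //; exact: measurable_funX.
- by apply/measurable_EFinP; exact: measurable_funX.
- by move=> x _; rewrite lee_fin ger0_norm// sqr_ge0.
Qed.

Lemma fin_sq_le f (h : T -> R) : measurable_fun D f -> 
  m.-integrable D (EFin \o h) -> (forall x, D x -> f x ^+ 2 <= h x) -> fin_sq f.
Proof.
move=> mf ih fh.
have/integrableP[_] : m.-integrable D (EFin \o (fun x => f x ^+ 2)).
  apply: (le_integrable mD _ _ ih).
    by apply/measurable_EFinP; exact: measurable_funX.
  move=> x Dx; rewrite lee_fin ger0_norm ?sqr_ge0//.
  by rewrite (le_trans (fh _ Dx))// ler_norm.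
apply: le_lt_trans; apply: ge0_le_integral => //=.
- by move=> x _; rewrite lee_fin sqr_ge0.
- by apply/measurable_EFinP; exact: measurable_funX.
- by do 2 apply: measurableT_comp => //; exact: measurable_funX.
- by move=> x _; rewrite lee_fin ler_norm.
Qed.

Lemma integrable_EFinD f g : m.-integrable D (EFin \o f) ->
  m.-integrable D (EFin \o g) -> m.-integrable D (EFin \o (fun x => f x + g x)).
Proof. by move=> hf hg; exact: (integrableD mD hf hg). Qed.

Lemma integrable_EFinZ k f : m.-integrable D (EFin \o f) ->
  m.-integrable D (EFin \o (fun x => k * f x)).
Proof. by move=> hf; exact: (integrableZl mD k hf). Qed.

Lemma fin_sqD f g : measurable_fun D f -> measurable_fun D g ->
  fin_sq f -> fin_sq g -> fin_sq (fun x => f x + g x).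
Proof.
move=> mf mg ff fg.
apply: (@fin_sq_le _ (fun x => 2 * f x ^+ 2 + 2 * g x ^+ 2)).
- exact: measurable_funD.
- by apply: integrable_EFinD; apply: integrable_EFinZ; exact: integrable_sq.
- by move=> x _; have := sqr_ge0 (f x - g x); nra.
Qed.

Lemma fin_sqM (B : R) (k f : T -> R) : measurable_fun D f -> measurable_fun D k ->
  (forall x, D x -> `|k x| <= B) -> fin_sq f -> fin_sq (fun x => k x * f x).
Proof.
move=> mf mk kB ff.
apply: (@fin_sq_le _ (fun x => B ^+ 2 * f x ^+ 2)).
- exact: measurable_funM.
- by apply: integrable_EFinZ; exact: integrable_sq.
- move=> x Dx; rewrite exprMn ler_wpM2r ?sqr_ge0//.
  by have := kB _ Dx; rewrite ler_norml => /andP[? ?]; nra.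
Qed.

Lemma integrableM_sq f g : measurable_fun D f -> measurable_fun D g ->
  fin_sq f -> fin_sq g -> m.-integrable D (EFin \o (fun x => f x * g x)).
Proof.
move=> mf mg ff fg.
apply: (@le_integrable _ _ _ _ _ mD _ (EFin \o (fun x => f x ^+ 2 + g x ^+ 2))).
- by apply/measurable_EFinP; exact: measurable_funM.
- move=> x Dx; rewrite /= lee_fin [leRHS]ger0_norm; last by rewrite addr_ge0 ?sqr_ge0.
  by rewrite ler_norml; apply/andP; split; have := sqr_ge0 (f x - g x);
   have := sqr_ge0 (f x + g x); nra.
- by apply: integrable_EFinD; exact: integrable_sq.
Qed.

Lemma integrable_of_bounded (B : R) f : (m D < +oo)%E -> measurable_fun D f ->
  (forall x, D x -> `|f x| <= B) -> m.-integrable D (EFin \o f).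
Proof.
move=> mDoo mf fB; apply: measurable_bounded_integrable => //.
exists B; split; rewrite ?num_real// => y By x Dx.
exact: le_trans (fB _ Dx) (ltW By).
Qed.

Lemma fin_sq_bounded (B : R) f : (m D < +oo)%E -> measurable_fun D f ->
  (forall x, D x -> `|f x| <= B) -> fin_sq f.
Proof.
move=> mDoo mf fB; apply: (@fin_sq_le _ (fun=> B ^+ 2)) => //.
  by apply: (@integrable_of_bounded (B ^+ 2)) => // x _; rewrite ger0_norm// sqr_ge0.
by move=> x Dx; have := fB _ Dx; rewrite ler_norml => /andP[? ?]; nra.
Qed.

(** Limits of partial sums and limits of cutoffs are both exchanged with real-valued integrals
    through this form. *)
Lemma Rintegral_dominated (f_ : nat -> T -> R) f (h : T -> R) :
  (forall n, measurable_fun D (f_ n)) ->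
  (forall x, D x -> f_ ^~ x @ \oo --> f x) ->
  m.-integrable D (EFin \o h) ->
  (forall n x, D x -> `|f_ n x| <= h x) ->
  m.-integrable D (EFin \o f) /\
  (fun n => Rintegral m D (f_ n)) @ \oo --> Rintegral m D f.
Proof.
move=> mf_ cvf ih fh.
have mf : measurable_fun D f by exact: measurable_fun_cvg mf_ cvf.
have [||||| iF _ cvF] := @dominated_convergence _ _ _ m D mD
  (fun n => EFin \o f_ n) (EFin \o f) (EFin \o h).
- by move=> n; apply/measurable_EFinP.
- exact/measurable_EFinP.
- apply: aeW => x Dx; apply: cvg_EFin; last exact: cvf.
  exact: nearW.
- exact: ih.
- by apply: aeW => x n Dx; rewrite lee_fin fh.
split => //.
apply: fine_cvg; rewrite fineK//; exact: integrable_fin_num.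
Qed.

End SquareIntegral.

(** * C^1 functions and integrals over a segment *)

Section Calculus.
Variable R : realType.
Notation mu := (@lebesgue_measure R).
Implicit Types f g : R -> R.

(** The derivative is a parameter, so that closed forms can be handled without rewriting [derive1];
    [c1_test] and [c1_derive1] translate from and to the test classes of the definitions. *)
Definition c1 f f' := (forall x, is_derive x (1 : R) f (f' x)) /\ continuous f'.

Lemma c1_test f : (forall x, derivable f x 1) -> continuous (derive1 f) ->
  c1 f (derive1 f).
Proof.
move=> df cf; split => // x; apply: DeriveDef => //.
by rewrite derive1E.
Qed.

Lemma c1_continuous f f' : c1 f f' -> continuous f.
Proof.
move=> [df _] x; apply: differentiable_continuous; apply/derivable1_diffP.
exact: (@ex_derive _ _ _ _ _ _ _ (df x)).
Qed.

Lemma c1_derive1 f f' : c1 f f' -> derive1 f = f'.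
Proof.
by move=> [df _]; apply/funext => x; rewrite derive1E (@derive_val _ _ _ _ _ _ _ (df x)).
Qed.

Lemma c1M f f' g g' : c1 f f' -> c1 g g' ->
  c1 (fun x => f x * g x) (fun x => f' x * g x + f x * g' x).
Proof.
move=> hf hg; have cf := c1_continuous hf; have cg := c1_continuous hg.
case: hf => df cf'; case: hg => dg cg'; split.
  move=> x; have h := is_deriveM (df x) (dg x).
  by apply: (is_derive_eq h); rewrite /GRing.scale/= addrC (mulrC (f' x)).
by move=> x; apply: cvgD; apply: cvgM;
  [exact: cf'|exact: cg|exact: cf|exact: cg'].
Qed.

Lemma c1_oo_LR f f' a b : c1 f f' -> derivable_oo_LRcontinuous f a b.
Proof.
move=> hf; have cf := c1_continuous hf; case: hf => df _; split.
- by move=> x _; exact: (@ex_derive _ _ _ _ _ _ _ (df x)).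
- by apply: cvg_at_right_filter; exact: cf.
- by apply: cvg_at_left_filter; exact: cf.
Qed.

Lemma within_continuous f (A : set R) : continuous f -> {within A, continuous f}.
Proof. by move=> cf; exact: continuous_subspaceT. Qed.

Lemma integrable_continuous f a b : continuous f ->
  mu.-integrable `[a, b] (EFin \o f).
Proof.
move=> cf; apply: continuous_compact_integrable; first exact: segment_compact.
exact: within_continuous.
Qed.

Lemma Rintegral_c1 f f' a b : a <= b -> c1 f f' ->
  Rintegral mu `[a, b] f' = f b - f a.
Proof.
rewrite le_eqVlt => /predU1P[->|ab] hf.
  by rewrite set_itv1 Rintegral_set1 subrr.
rewrite /Rintegral (@continuous_FTC2 _ _ f)//.
- by apply: within_continuous; exact: hf.2.
- exact: c1_oo_LR hf.
- by move=> x _; rewrite (c1_derive1 hf).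
Qed.

Lemma Rintegral_byparts f f' g g' a b : a < b -> c1 f f' -> c1 g g' ->
  Rintegral mu `[a, b] (fun x => f x * g' x) =
  f b * g b - f a * g a - Rintegral mu `[a, b] (fun x => f' x * g x).
Proof.
move=> ab hf hg; apply: Rintegration_by_parts => //.
- by apply: within_continuous; exact: hf.2.
- exact: c1_oo_LR hf.
- by move=> x _; rewrite (c1_derive1 hf).
- by apply: within_continuous; exact: hg.2.
- exact: c1_oo_LR hg.
- by move=> x _; rewrite (c1_derive1 hg).
Qed.

Lemma lebesgue_itvcc_fin (a b : R) : (mu `[a, b] < +oo)%E.
Proof. exact/compact_finite_measure/segment_compact. Qed.

Lemma sq_int_bounded (a b B : R) f : measurable_fun `[a, b]%classic f ->
  (forall x, `[a, b]%classic x -> `|f x| <= B) -> sq_int_on `[a, b] f.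
Proof.
move=> mf fB; split => //; apply: (@fin_sq_bounded _ _ _ _ _ _ B) => //.
exact: lebesgue_itvcc_fin.
Qed.

Lemma continuous_bounded f a b : continuous f ->
  exists B : R, forall x, `[a, b]%classic x -> `|f x| <= B.
Proof.
move=> cf; have cfa : {within `[a, b], continuous f} by exact: within_continuous.
have /compact_bounded[M [_ mrt]] := continuous_compact cfa (@segment_compact _ a b).
exists (M + 1) => x xab; apply: mrt; first by rewrite ltrDl.
by exists x.
Qed.

Lemma sq_int_continuous a b f : continuous f -> sq_int_on `[a, b] f.
Proof.
move=> cf; have [B fB] := continuous_bounded a b cf.
apply: sq_int_bounded fB.
by apply: measurable_funTS; exact: continuous_measurable_fun.
Qed.

Lemma sq_intD (D : set R) f g : measurable D -> sq_int_on D f -> sq_int_on D g ->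
  sq_int_on D (fun x => f x + g x).
Proof.
by move=> mD [mf ff] [mg fg]; split; [exact: measurable_funD|exact: fin_sqD].
Qed.

Lemma sq_intZ (D : set R) k f : measurable D -> sq_int_on D f ->
  sq_int_on D (fun x => k * f x).
Proof.
move=> mD [mf ff]; split; first exact: measurable_funM.
exact: (@fin_sqM _ _ _ _ _ _ `|k|).
Qed.

Lemma integrable_sq_int (D : set R) f g : measurable D -> sq_int_on D f ->
  sq_int_on D g -> mu.-integrable D (EFin \o (fun x => f x * g x)).
Proof. by move=> mD [mf ff] [mg fg]; exact: integrableM_sq. Qed.

Lemma sq_int_integrable a b f : sq_int_on `[a, b] f ->
  mu.-integrable `[a, b] (EFin \o f).
Proof.
(* On a bounded interval f = f * 1 is a product of two square integrable functions. *)
move=> hf; have := @integrable_sq_int `[a, b] f (fun=> 1).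
have -> : (fun x => f x * 1) = f by apply/funext => x; rewrite mulr1.
apply => //; by apply: sq_int_continuous => x; exact: cvg_cst.
Qed.

Lemma continuous_psum (u : nat -> R -> R) N : (forall n, continuous (u n)) ->
  continuous (fun x => \sum_(0 <= k < N) u k x).
Proof.
move=> cu; elim: N => [|N IH] x.
  rewrite (_ : (fun y => _) = (fun=> 0)); first exact: cvg_cst.
  by apply/funext => y; rewrite big_geq.
rewrite (_ : (fun y => _) = (fun y => \sum_(0 <= k < N) u k y + u N y)).
  by apply: cvgD; [exact: IH|exact: cu].
by apply/funext => y; rewrite big_nat_recr.
Qed.

Lemma continuousZ k f : continuous f -> continuous (fun x => k * f x).
Proof. by move=> cf x; apply: cvgM; [exact: cvg_cst|exact: cf]. Qed.

Lemma integrableM_continuous a b f g : mu.-integrable `[a, b] (EFin \o f) ->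
  continuous g -> mu.-integrable `[a, b] (EFin \o (fun x => f x * g x)).
Proof.
move=> hf cg; have [B gB] := continuous_bounded a b cg.
have mf : measurable_fun `[a, b]%classic f.
  by case/integrableP : hf => /measurable_EFinP.
apply: (@le_integrable _ _ _ mu _ _ _ (EFin \o (fun x => B * f x))) => //.
- apply/measurable_EFinP; apply: measurable_funM => //.
  by apply: measurable_funTS; exact: continuous_measurable_fun.
- move=> x Dx; rewrite /= lee_fin !normrM mulrC ler_wpM2r//.
  by rewrite (le_trans (gB _ Dx))// ler_norm.
- exact: integrable_EFinZ.
Qed.

End Calculus.

(** * Absolutely convergent expansions *)
Section Series.
Variable R : realType.
Notation mu := (@lebesgue_measure R).
Implicit Types a b : nat -> R.

Definition asummable a := cvgn (series (fun n => `|a n|)).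

Lemma asummable_le a b : (forall n, `|a n| <= `|b n|) -> asummable b -> asummable a.
Proof. by move=> ab sb; exact: series_le_cvg sb. Qed.

Lemma asummable_bounded a (B : R) : (forall N, \sum_(0 <= n < N) `|a n| <= B) ->
  asummable a.
Proof.
move=> aB; apply: nondecreasing_is_cvgn.
  by apply/nondecreasing_seqP => n; rewrite seriesSr lerDl.
exists B => _ [N _ <-]; exact: aB.
Qed.

Lemma asummableD a b : asummable a -> asummable b -> asummable (fun n => a n + b n).
Proof.
move=> sa sb.
have s : asummable (fun n => `|a n| + `|b n|).
  rewrite /asummable.
  have -> : (fun n => `| `|a n| + `|b n| |) = (fun n => `|a n|) + (fun n => `|b n|).
    by apply/funext => n; rewrite ger0_norm// addr_ge0.
  exact: is_cvg_seriesD.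
by apply: asummable_le s => n; rewrite (le_trans (ler_normD _ _))// ler_norm.
Qed.

Lemma asummableZ k a : asummable a -> asummable (fun n => k * a n).
Proof.
move=> sa; rewrite /asummable.
have -> : (fun n => `|k * a n|) = `|k| *: (fun n => `|a n|).
  by apply/funext => n; rewrite normrM.
exact: is_cvg_seriesZ.
Qed.

Lemma asummable_cvg a : asummable a -> cvgn (series a).
Proof. exact: normed_cvg. Qed.

Definition asum a := limn (series (fun n => `|a n|)).

Lemma asum_ge a N : asummable a -> \sum_(0 <= n < N) `|a n| <= asum a.
Proof.
move=> sa; apply: (nondecreasing_cvgn_le _ sa N).
by apply/nondecreasing_seqP => n; rewrite seriesSr lerDl.
Qed.

Lemma asummable_inv_sq : asummable (fun n => (n.+1%:R ^+ 2)^-1).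
Proof.
apply: (@asummable_bounded _ 2) => -[|N]; first by rewrite big_geq.
(* The sharper bound makes the induction go through: 1 / (y + 1)^2 is at most 1 / (y (y + 1)) = 1 /
   y - 1 / (y + 1), which telescopes. *)
suff : \sum_(0 <= n < N.+1) `|(n.+1%:R ^+ 2)^-1 : R| <= 2 - N.+1%:R^-1.
  by move/le_trans; apply; rewrite gerBl invr_ge0.
elim: N => [|N IH].
  by rewrite big_nat1 expr1n invr1 normr1; lra.
rewrite big_nat_recr//= (le_trans (lerD IH (lexx _)))//.
rewrite ger0_norm ?invr_ge0 ?sqr_ge0//.
rewrite -[N.+2%:R]natr1; set y := N.+1%:R.
have y0 : 0 < y :> R by [].
have y1 : 0 < y + 1 by rewrite addr_gt0.
have -> : y^-1 = (y + 1)^-1 + (y * (y + 1))^-1.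
  by field; rewrite !gt_eqF.
suff : ((y + 1) ^+ 2)^-1 <= (y * (y + 1))^-1.
  by move: (_ ^- 2) (_ * _)^-1 (_ + _)^-1 => p q r; lra.
rewrite lef_pV2 ?posrE ?exprn_gt0 ?mulr_gt0//; nra.
Qed.

Variable e : nat -> R -> R.
Hypothesis ce : forall n, continuous (e n).
Hypothesis e1 : forall n x, `|e n x| <= 1.

(** The family [e] will be the sines (for w and w_xx) or the cosines (for w_x and its time
    integral). Thanks to the uniform bound 1, [asummable] coefficients give convergence at every
    point, and the constant [asum a] dominates all partial sums. *)
Definition fsum a x := limn (series (fun n => a n * e n x)).

Lemma norm_mulr_e a n x : `|a n * e n x| <= `|a n|.
Proof. by rewrite normrM ler_piMr// e1. Qed.

Lemma fsum_cvg a x : asummable a -> series (fun n => a n * e n x) @ \oo --> fsum a x.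
Proof.
move=> sa; apply: asummable_cvg; apply: asummable_le sa => n.
exact: norm_mulr_e.
Qed.

Lemma norm_fpartial a x N : asummable a -> `|series (fun n => a n * e n x) N| <= asum a.
Proof.
move=> sa; rewrite (le_trans _ (asum_ge N sa))// (le_trans (ler_norm_sum _ _ _))//.
by apply: ler_sum => n _; exact: norm_mulr_e.
Qed.

Lemma norm_fsum a x : asummable a -> `|fsum a x| <= asum a.
Proof.
move=> sa; have h : `|series (fun n => a n * e n x) N| @[N --> \oo] --> `|fsum a x|.
  by apply: cvg_norm; exact: fsum_cvg.
have <- := cvg_lim _ h => //.
apply: limr_le; first by apply/cvg_ex; eexists; exact: h.
by apply: nearW => N; exact: norm_fpartial.
Qed.

Lemma measurable_fpartial a N (D : set R) :
  measurable_fun D (fun x => series (fun n => a n * e n x) N).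
Proof.
apply: measurable_funTS; apply: continuous_measurable_fun.
by apply: continuous_psum => n; exact: continuousZ.
Qed.

Lemma measurable_fsum a (D : set R) : asummable a -> measurable_fun D (fsum a).
Proof.
move=> sa; apply: (@measurable_fun_cvg _ _ _ D (fun N x => series (fun n => a n * e n x) N)).
  by move=> N; exact: measurable_fpartial.
by move=> x _; exact: fsum_cvg.
Qed.

(** Joint measurability passes to the limit from the partial sums, which are finite sums of a
    function of t times a function of x. The coefficients are taken merely measurable in t because
    some of them jump at t = 0. *)
Lemma measurable_fsum2 (A : R -> nat -> R) : (forall t, asummable (A t)) ->
  (forall n, measurable_fun setT (A ^~ n)) ->
  measurable_fun setT (fun p : R * R => fsum (A p.2) p.1).
Proof.
move=> sA mA; apply: (@measurable_fun_cvg _ _ _ _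
  (fun N (p : R * R) => series (fun n => A p.2 n * e n p.1) N)); last first.
  by move=> x _; exact: fsum_cvg.
move=> N; rewrite /series/=; elim: N => [|N IH].
  by under eq_fun do rewrite big_geq//; exact: measurable_cst.
under eq_fun do rewrite big_nat_recr//=.
apply: measurable_funD => //; apply: measurable_funM.
  by apply: (measurableT_comp (mA N)); exact: measurable_snd.
apply: (@measurableT_comp _ _ _ _ _ _ (e N)); [|exact: measurable_fst].
exact: continuous_measurable_fun.
Qed.

Lemma sq_int_fsum l r a : asummable a -> sq_int_on `[l, r] (fsum a).
Proof.
move=> sa; apply: (@sq_int_bounded _ _ _ (asum a)).
  exact: measurable_fsum.
by move=> x _; exact: norm_fsum.
Qed.

Lemma Rintegral_fpartial l r a (g : R -> R) N : mu.-integrable `[l, r] (EFin \o g) ->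
  Rintegral mu `[l, r] (fun x => series (fun n => a n * e n x) N * g x) =
  series (fun n => a n * Rintegral mu `[l, r] (fun x => e n x * g x)) N /\
  mu.-integrable `[l, r] (EFin \o (fun x => series (fun n => a n * e n x) N * g x)).
Proof.
move=> ig; rewrite /series/=.
have ieg n : mu.-integrable `[l, r] (EFin \o (fun x => a n * (e n x * g x))).
  apply: integrable_EFinZ => //; rewrite (_ : (fun x => _) = (fun x => g x * e n x)).
    exact: integrableM_continuous.
  by apply/funext => x; rewrite mulrC.
have ie n : mu.-integrable `[l, r] (EFin \o (fun x => e n x * g x)).
  rewrite (_ : (fun x => _) = (fun x => g x * e n x)).
    exact: integrableM_continuous.
  by apply/funext => x; rewrite mulrC.
elim: N => [|N [IH1 IH2]].
  have -> : (fun x => (\sum_(0 <= k < 0) a k * e k x) * g x) = (fun=> 0).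
    by apply/funext => x; rewrite big_geq// mul0r.
  rewrite big_geq//; split; first by rewrite Rintegral_cst// mul0r.
  by apply: integrable_continuous => x; exact: cvg_cst.
have -> : (fun x => (\sum_(0 <= k < N.+1) a k * e k x) * g x) =
   (fun x => (\sum_(0 <= k < N) a k * e k x) * g x + a N * (e N x * g x)).
  by apply/funext => x; rewrite big_nat_recr//= mulrDl mulrA.
split; last exact: integrable_EFinD.
by rewrite big_nat_recr//= -IH1 RintegralD// RintegralZl.
Qed.

Lemma Rintegral_fsum l r a (g : R -> R) : asummable a ->
  mu.-integrable `[l, r] (EFin \o g) ->
  series (fun n => a n * Rintegral mu `[l, r] (fun x => e n x * g x)) @ \oo -->
  Rintegral mu `[l, r] (fun x => fsum a x * g x).
Proof.
move=> sa ig.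
have -> : series (fun n => a n * Rintegral mu `[l, r] (fun x => e n x * g x)) =
  (fun N => Rintegral mu `[l, r] (fun x => series (fun n => a n * e n x) N * g x)).
  by apply/funext => N; rewrite (Rintegral_fpartial _ _ ig).1.
have mg : measurable_fun `[l, r]%classic g.
  by case/integrableP : ig => /measurable_EFinP.
apply: (@Rintegral_dominated _ _ _ mu _ _ _ _ (fun x => asum a * `|g x|) _ _ _ _).2 => //.
- by move=> N; apply: measurable_funM => //; exact: measurable_fpartial.
- by move=> x _; apply: cvgM; [exact: fsum_cvg|exact: cvg_cst].
- by apply: integrable_EFinZ => //; exact: integrable_norm.
- by move=> N x _; rewrite normrM ler_wpM2r// norm_fpartial.
Qed.

End Series.

(** * Sine and cosine series *)
Section Bessel.
Variables (R : realType) (L : R).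
Hypothesis L0 : 0 < L.
Notation mu := (@lebesgue_measure R).
Notation II f := (Rintegral mu `[0, L] f).
Variable e : nat -> R -> R.
Hypothesis ce : forall n, continuous (e n).
Hypothesis e1 : forall n x, `|e n x| <= 1.
Hypothesis oe : forall n m, II (fun x => e n x * e m x) = (n == m)%:R * (L / 2).

(** The factor is the inverse of L / 2, the squared norm of each mode. *)
Definition coef (f : R -> R) n := 2 / L * II (fun x => e n x * f x).

Lemma coefK f n : II (fun x => e n x * f x) = L / 2 * coef f n.
Proof. by rewrite /coef; field; rewrite gt_eqF. Qed.

(** Expand the integral of (f - p)^2 >= 0 for the partial sum p: by orthogonality the integrals of p
    f and of p^2 both equal L / 2 times the sum of squares. *)
Lemma bessel f N : sq_int_on `[0, L] f ->
  \sum_(0 <= n < N) coef f n ^+ 2 <= 2 / L * II (fun x => f x ^+ 2).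
Proof.
move=> hf; pose p x := series (fun n => coef f n * e n x) N.
have iff := sq_int_integrable hf.
have cp : continuous p by apply: continuous_psum => n; exact: continuousZ.
have hp : sq_int_on `[0, L] p by exact: sq_int_continuous.
have ip := sq_int_integrable hp.
set S := \sum_(0 <= n < N) coef f n ^+ 2.
have pf : II (fun x => p x * f x) = L / 2 * S.
  rewrite (Rintegral_fpartial ce (coef f) N iff).1 /series/= mulr_sumr.
  by apply: eq_bigr => n _; rewrite coefK expr2 mulrCA.
have pe n : (n < N)%N -> II (fun x => e n x * p x) = L / 2 * coef f n.
  move=> nN; under eq_Rintegral do rewrite mulrC.
  rewrite (Rintegral_fpartial ce (coef f) N (integrable_continuous _ _ (@ce n))).1.
  rewrite /series/= big_mkord (bigD1 (Ordinal nN))//= big1 ?addr0; last first.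
    move=> i /eqP hi; rewrite oe; case: eqP => [ein|]; last by rewrite mul0r mulr0.
    by exfalso; apply: hi; apply: val_inj.
  by rewrite oe eqxx mul1r mulrC.
have pp : II (fun x => p x * p x) = L / 2 * S.
  rewrite (Rintegral_fpartial ce (coef f) N ip).1 /series/= mulr_sumr.
  rewrite big_nat [RHS]big_nat; apply: eq_bigr => n /andP[_ nN].
  by rewrite pe// expr2 mulrCA.
have h0 : 0 <= II (fun x => f x * f x + (-2 * (p x * f x) + p x * p x)).
  apply: Rintegral_ge0 => x _.
  by have := sqr_ge0 (f x - p x); nra.
have if2 : mu.-integrable `[0, L] (EFin \o (fun x => f x * f x)).
  exact: integrable_sq_int.
have ipf : mu.-integrable `[0, L] (EFin \o (fun x => p x * f x)).
  exact: integrable_sq_int.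
have ip2 : mu.-integrable `[0, L] (EFin \o (fun x => p x * p x)).
  exact: integrable_sq_int.
move: h0; rewrite RintegralD//; last first.
  by apply: integrable_EFinD => //; exact: integrable_EFinZ.
rewrite RintegralD//; last exact: integrable_EFinZ.
rewrite RintegralZl// pf pp.
have -> : II (fun x => f x ^+ 2) = II (fun x => f x * f x) by [].
move: (II _) => J hJ.
have -> : S = 2 / L * (L / 2 * S) by field; rewrite gt_eqF.
apply: ler_wpM2l; first by rewrite divr_ge0// ltW.
by move: hJ; move: (L / 2 * S) => W; lra.
Qed.

Lemma asummable_coef_sq f : sq_int_on `[0, L] f -> asummable (fun n => coef f n ^+ 2).
Proof.
move=> hf; apply: asummable_bounded => N.
under eq_bigr do rewrite ger0_norm ?sqr_ge0//.
exact: bessel.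
Qed.

(** Riemann-Lebesgue, since the squares of the coefficients are the terms of a convergent series. *)
Lemma coef_cvg0 f : sq_int_on `[0, L] f -> coef f @ \oo --> 0.
Proof.
move=> hf; have h := cvg_series_cvg_0 (asummable_coef_sq hf).
apply/norm_cvg0P.
have -> : (fun n => `|coef f n|) = (fun n => Num.sqrt `|coef f n ^+ 2|).
  by apply/funext => n; rewrite [X in Num.sqrt X]ger0_norm ?sqr_ge0// sqrtr_sqr.
rewrite -[X in _ --> X]sqrtr0.
apply: continuous_cvg => //; exact: sqrt_continuous.
Qed.

Lemma coef_bounded f : sq_int_on `[0, L] f -> exists B, forall n, `|coef f n| <= B.
Proof.
(* If c^2 <= K then |c| <= K + 1, which spares a square root. *)
move=> hf; exists (2 / L * II (fun x => f x ^+ 2) + 1) => n.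
have h : coef f n ^+ 2 <= 2 / L * II (fun x => f x ^+ 2).
  apply: le_trans (bessel n.+1 hf); rewrite big_nat_recr//= lerDr.
  by apply: sumr_ge0 => i _; rewrite sqr_ge0.
rewrite (le_trans _ (lerD h (lexx 1)))// ler_norml; apply/andP; split; nra.
Qed.

(** Parseval for summable coefficients: termwise integration against [e n] recovers a n, and
    termwise integration against the sum itself then gives the squares. *)
Lemma Rintegral_fsum_sq a : asummable a ->
  series (fun n => a n ^+ 2) @ \oo --> 2 / L * II (fun x => fsum e a x ^+ 2).
Proof.
move=> sa.
have ifs := sq_int_integrable (sq_int_fsum ce e1 0 L sa).
have cf n : II (fun x => e n x * fsum e a x) = L / 2 * a n.
  under eq_Rintegral do rewrite mulrC.
  have h := Rintegral_fsum ce e1 sa (integrable_continuous 0 L (@ce n)).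
  rewrite -(cvg_lim _ h)//; apply: cvg_lim => //.
  (* Only the term of index n survives, so the partial sums are constant once they contain it. *)
  apply: cvg_near_cst; exists n.+1 => // N /= nN.
  rewrite /series/= big_mkord (bigD1 (Ordinal nN))//= big1 ?addr0; last first.
    move=> i /eqP hi; rewrite oe; case: eqP => [ein|]; last by rewrite mul0r mulr0.
    by exfalso; apply: hi; apply: val_inj.
  by rewrite oe eqxx mul1r mulrC.
have h := Rintegral_fsum ce e1 sa ifs.
have -> : series (fun n => a n ^+ 2) =
  (fun N => 2 / L * series (fun n => a n * II (fun x => e n x * fsum e a x)) N).
  apply/funext => N; rewrite /series/= mulr_sumr; apply: eq_bigr => n _.
  by rewrite cf; field; rewrite gt_eqF.
by apply: cvgM; [exact: cvg_cst|exact: h].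
Qed.

End Bessel.

(** * Orthogonality of the trigonometric modes *)

Section Trigonometric.
Variables (R : realType) (L : R).
Hypothesis L0 : 0 < L.
Notation mu := (@lebesgue_measure R).
Notation II f := (Rintegral mu `[0, L] f).

(** The shift makes index 0 the lowest sine mode and leaves out the constant cosine. *)
Definition al n : R := n.+1%:R * (pi / L).
Definition sn n (x : R) := sin (al n * x).
Definition kn n (x : R) := cos (al n * x).

Lemma al_gt0 n : 0 < al n.
Proof. by rewrite mulr_gt0// divr_gt0// pi_gt0. Qed.

Lemma al_inj n m : al n = al m -> n = m.
Proof.
move/mulIf => h; have /h/eqP : pi / L != 0 by rewrite gt_eqF// divr_gt0// pi_gt0.
by rewrite eqr_nat eqSS => /eqP.
Qed.

Lemma is_derive_lin (c x : R) : is_derive x 1 (fun y : R => c * y) c.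
Proof.
have h := is_deriveZ c (is_derive_id x (1 : R)).
by apply: (is_derive_eq h); rewrite /GRing.scale/= mulr1.
Qed.

Lemma continuous_lin (c : R) : continuous (fun y : R => c * y).
Proof. by move=> x; apply: cvgM; [exact: cvg_cst|exact: cvg_id]. Qed.

Lemma c1_sinl c : c1 (fun x : R => sin (c * x)) (fun x => c * cos (c * x)).
Proof.
split.
  move=> x;
    have h := @is_derive1_comp _ sin
    (fun y : R => c * y) x _ _ (is_derive_sin _) (is_derive_lin c x).
  by apply: (is_derive_eq h); rewrite mulrC.
move=> x; apply: cvgM; first exact: cvg_cst.
by apply: continuous_comp; [exact: continuous_lin|exact: continuous_cos].
Qed.

Lemma c1_cosl c : c1 (fun x : R => cos (c * x)) (fun x => - c * sin (c * x)).
Proof.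
split.
  move=> x;
    have h := @is_derive1_comp _ cos
    (fun y : R => c * y) x _ _ (is_derive_cos _) (is_derive_lin c x).
  by apply: (is_derive_eq h); rewrite mulrC mulrN mulNr.
move=> x; apply: cvgM; first exact: cvg_cst.
by apply: continuous_comp; [exact: continuous_lin|exact: continuous_sin].
Qed.

Lemma c1_sn n : c1 (sn n) (fun x => al n * kn n x).
Proof. exact: c1_sinl. Qed.

Lemma c1_kn n : c1 (kn n) (fun x => - al n * sn n x).
Proof. exact: c1_cosl. Qed.

Lemma continuous_sn n : continuous (sn n).
Proof. exact: c1_continuous (c1_sn n). Qed.

Lemma continuous_kn n : continuous (kn n).
Proof. exact: c1_continuous (c1_kn n). Qed.

Lemma sn_le1 n x : `|sn n x| <= 1. Proof. exact: sin_max. Qed.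
Lemma kn_le1 n x : `|kn n x| <= 1. Proof. exact: cos_max. Qed.

Lemma sn0 n : sn n 0 = 0. Proof. by rewrite /sn mulr0 sin0. Qed.

Lemma sin_natpi n : sin (n%:R * pi) = 0 :> R.
Proof.
elim: n => [|n IH]; first by rewrite mul0r sin0.
by rewrite -natr1 mulrDl mul1r sinD IH sinpi mul0r mulr0 addr0.
Qed.

Lemma snL n : sn n L = 0.
Proof. by rewrite /sn /al -mulrA divfK ?gt_eqF// sin_natpi. Qed.

(** The sines vanish at both ends, so psi may be arbitrary there; this is the source of all the
    Dirichlet identities below. *)
Lemma int_sn_deriv n psi psi' : c1 psi psi' ->
  II (fun x => sn n x * psi' x) = - al n * II (fun x => kn n x * psi x).
Proof.
move=> hp; rewrite (Rintegral_byparts L0 (c1_sn n) hp) sn0 snL !mul0r subrr sub0r.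
under eq_Rintegral do rewrite -mulrA.
rewrite RintegralZl// ?mulNr//; apply: integrable_continuous => x.
by apply: cvgM; [exact: continuous_kn|exact: (c1_continuous hp)].
Qed.

(** The cosines do not vanish at the ends, so here phi has to. *)
Lemma int_kn_deriv n phi phi' : c1 phi phi' -> phi 0 = 0 -> phi L = 0 ->
  II (fun x => kn n x * phi' x) = al n * II (fun x => sn n x * phi x).
Proof.
move=> hp p0 pL; rewrite (Rintegral_byparts L0 (c1_kn n) hp) p0 pL !mulr0 subrr sub0r.
under eq_Rintegral do rewrite -mulrA.
rewrite RintegralZl// ?mulNr ?opprK//; apply: integrable_continuous => x.
by apply: cvgM; [exact: continuous_sn|exact: (c1_continuous hp)].
Qed.

(** Sines and cosines are treated together. One integration by parts relates the two integrals K and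
    S by al m K = al n S. For n = m they are equal, and cos^2 + sin^2 = 1 fixes their sum to L. For
    n != m, exchanging the indices gives al n K = al m S, and the 2 by 2 system has a nonzero
    determinant. *)
Lemma orthogonal_sn_kn n m :
  II (fun x => sn n x * sn m x) = (n == m)%:R * (L / 2) /\
  II (fun x => kn n x * kn m x) = (n == m)%:R * (L / 2).
Proof.
have key p q : al q * II (fun x => kn p x * kn q x) = al p * II (fun x => sn p x * sn q x).
  rewrite -(int_kn_deriv p (c1_sn q) (sn0 q) (snL q)).
  under [RHS]eq_Rintegral do rewrite mulrCA.
  rewrite RintegralZl//; apply: integrable_continuous => x.
  by apply: cvgM; exact: continuous_kn.
have [->|nm] := eqVneq n m.
  have am0 : al m != 0 by rewrite gt_eqF// al_gt0.
  have ekm := mulfI am0 (key m m).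
  have : II (fun x => kn m x * kn m x + sn m x * sn m x) = L.
    under eq_Rintegral do rewrite -!expr2 cos2Dsin2.
    rewrite (@Rintegral_c1 _ (fun y => 1 * y) (fun=> 1)) ?ltW//; first by rewrite mulr0 mul1r subr0.
    by split; [move=> x; exact: is_derive_lin|move=> x; exact: cvg_cst].
  rewrite RintegralD// ?ekm; first by rewrite mul1r; split; lra.
  - by apply: integrable_continuous => x; apply: cvgM; exact: continuous_kn.
  - by apply: integrable_continuous => x; apply: cvgM; exact: continuous_sn.
have k1 := key n m; have k2 := key m n.
have sk : II (fun x => kn m x * kn n x) = II (fun x => kn n x * kn m x).
  by apply: eq_Rintegral => x _; rewrite mulrC.
have ss : II (fun x => sn m x * sn n x) = II (fun x => sn n x * sn m x).
  by apply: eq_Rintegral => x _; rewrite mulrC.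
rewrite sk ss in k2; rewrite !mul0r.
have d0 : al n ^+ 2 - al m ^+ 2 != 0.
  rewrite subr_sqr mulf_neq0//; last by rewrite gt_eqF// addr_gt0// al_gt0.
  by rewrite subr_eq0; apply: contra nm => /eqP/al_inj ->.
split; apply: (mulfI d0); rewrite mulr0; move: k1 k2;
  move: (II _) (II _) (al n) (al m) => P Q p q k1 k2.
- have -> : (p ^+ 2 - q ^+ 2) * P = p * (p * P) - q * (q * P) by ring.
  by rewrite -k1 -k2; ring.
- have -> : (p ^+ 2 - q ^+ 2) * Q = p * (p * Q) - q * (q * Q) by ring.
  by rewrite k1 k2; ring.
Qed.

Lemma orthogonal_sn n m : II (fun x => sn n x * sn m x) = (n == m)%:R * (L / 2).
Proof. exact: (orthogonal_sn_kn n m).1. Qed.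

Lemma orthogonal_kn n m : II (fun x => kn n x * kn m x) = (n == m)%:R * (L / 2).
Proof. exact: (orthogonal_sn_kn n m).2. Qed.

End Trigonometric.

(** * Pointwise convergence of sine series *)

Section PointwiseSine.
Variables (R : realType) (L : R).
Hypothesis L0 : 0 < L.
Notation mu := (@lebesgue_measure R).
Notation II f := (Rintegral mu `[0, L] f).
Notation b := (pi / L).

Lemma is_derive_quotient (f : R -> R) (x d : R) : is_derive x 1 f d ->
  h^-1 * (f (h + x) - f x) @[h --> 0^'] --> d.
Proof.
move=> [df <-]; rewrite /derive.
have -> : (fun h => h^-1 * (f (h + x) - f x)) =
          (fun h => h^-1 *: ((f \o shift x) (h *: (1 : R)) - f x)).
  by apply/funext => h; rewrite /= /GRing.scale/= mulr1.
exact: df.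
Qed.

(** A removable singularity: as f and g vanish at x, f / g is the ratio of their difference
    quotients at x, each of which converges. *)
Lemma continuous_quotient_zero (f g : R -> R) (x f' g' : R) :
  is_derive x 1 f f' -> is_derive x 1 g g' -> f x = 0 -> g x = 0 -> g' != 0 ->
  {for x, continuous (fun y => if y == x then f' / g' else f y / g y)}.
Proof.
move=> df dg fx gx g0.
apply/continuous_withinNshiftx; rewrite /= eqxx.
have h1 : (h^-1 * (f (h + x) - f x)) / (h^-1 * (g (h + x) - g x)) @[h --> 0^'] --> f' / g'.
  apply: cvgM; first exact: is_derive_quotient.
  by apply: cvgV => //; exact: is_derive_quotient.
apply: cvg_trans h1; apply: near_eq_cvg; near=> h.
have h0 : h != 0 by near: h; exact: nbhs_dnbhs_neq.
rewrite /= -subr_eq0 addrK (negbTE h0) fx gx !subr0.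
by rewrite invfM invrK mulrACA mulVf// mul1r.
Unshelve. all: by end_near. Qed.

(** Sines with unshifted index: [sinn 0] vanishes and supplies the initial value of the recurrence
    [sinn_rec]. *)
Definition sinn n (x : R) := sin (n%:R * b * x).

Lemma sinnS n : sinn n.+1 = sn L n. Proof. by []. Qed.

Lemma sinn_rec n x : sinn n.+2 x + sinn n x = 2 * cos (b * x) * sinn n.+1 x.
Proof.
rewrite /sinn.
have -> : n.+2%:R * b * x = n.+1%:R * b * x + b * x by rewrite -[n.+2%:R]natr1; ring.
have -> : n%:R * b * x = n.+1%:R * b * x - b * x by rewrite -[n.+1%:R]natr1; ring.
by rewrite sinD sinB; ring.
Qed.

Lemma bx_itv y : `[0, L]%classic y -> b * y \in `[0, pi].
Proof.
rewrite /= !in_itv/= => /andP[y0 yL].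
have b0 : 0 < b by rewrite divr_gt0// pi_gt0.
rewrite mulr_ge0 ?(ltW b0)//=.
by rewrite -[leRHS](@divfK _ L) ?gt_eqF// ler_wpM2l// ltW.
Qed.

(* After subtraction of a multiple of the first mode, [phi] becomes
   [(cos (b y) - cos (b x)) q y] with [q] bounded, so that the terms of the
   series telescope and only the coefficients of [q] of index [N] and [N + 1],
   which tend to 0 by Bessel's inequality, survive. *)
Lemma sine_series_pointwise phi phi' (x : R) : c1 phi phi' -> 0 < x < L ->
  series (fun n => coef L (sn L) phi n * sn L n x) @ \oo --> phi x.
Proof.
move=> hphi /andP[x0 xL].
have b0 : 0 < b by rewrite divr_gt0// pi_gt0.
have xI : `[0, L]%classic x by rewrite /= in_itv/= !ltW.
have sbx : 0 < sin (b * x).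
  rewrite sin_gt0_pi// mulr_gt0//=.
  by rewrite -[ltRHS](@divfK _ L) ?gt_eqF// ltr_pM2l.
have s1x : sinn 1 x != 0 by rewrite /sinn mul1r gt_eqF.
pose ka := phi x / sinn 1 x.
pose f y := phi y - ka * sinn 1 y.
pose D y := cos (b * y) - cos (b * x).
have cphi := c1_continuous hphi.
have cs1 : continuous (sinn 1) by exact: continuous_sn.
have df : is_derive x 1 f (phi' x - ka * (al L 0 * kn L 0 x)).
  apply: is_deriveB; first exact: hphi.1.
  have h := is_deriveZ ka ((c1_sn L 0).1 x).
  exact: h.
have dD : is_derive x 1 D (- b * sin (b * x)).
  have h := is_deriveB ((c1_cosl b).1 x) (is_derive_cst (cos (b * x)) x (1 : R)).
  by apply: (is_derive_eq h); rewrite subr0.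
have fx : f x = 0 by rewrite /f /ka divfK// subrr.
have Dx : D x = 0 by rewrite /D subrr.
have D'x : - b * sin (b * x) != 0 by rewrite mulf_neq0 ?oppr_eq0 ?gt_eqF.
pose q (y : R) := if y == x
  then (phi' x - ka * (al L 0 * kn L 0 x)) / (- b * sin (b * x)) else f y / D y.
have qx : {for x, continuous q} by exact: continuous_quotient_zero.
have cf : continuous f.
  move=> y; apply: cvgB; first exact: cphi.
  by apply: cvgM; [exact: cvg_cst|exact: cs1].
have cD : continuous D.
  move=> y; apply: cvgB; last exact: cvg_cst.
  exact: (c1_continuous (c1_cosl b)).
(* The cosine is injective on [0, pi], so x is the only zero of [D] on [0, L]. *)
have Dn0 y : `[0, L]%classic y -> y != x -> D y != 0.
  move=> yI; apply: contra; rewrite subr_eq0 => /eqP h.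
  have h2 := @cos_inj R (b * y) (b * x) (bx_itv yI) (bx_itv xI) h.
  by apply/eqP; apply: (mulfI (lt0r_neq0 b0)).
have fDq y : `[0, L]%classic y -> f y = D y * q y.
  move=> yI; rewrite /q; case: eqP => [->|/eqP yx]; first by rewrite fx Dx mul0r.
  by rewrite mulrC divfK// Dn0.
have cq : {within `[0, L], continuous q}.
  apply: continuous_in_subspaceT => y; rewrite inE => yI.
  have [->//|yx] := eqVneq y x.
  have h : f z / D z @[z --> y] --> f y / D y.
    by apply: cvgM; [exact: cf|apply: cvgV; [exact: Dn0|exact: cD]].
  rewrite /continuous_at {2}/q (negbTE yx).
  apply: cvg_trans h; apply: near_eq_cvg; near=> z.
  rewrite /q ifF//; apply/negbTE; near: z.
  exact: (open_nbhs_nbhs (conj (@open_neq _ x) yx)).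
have hq : sq_int_on `[0, L] q.
  have /compact_bounded[M [_ mrt]] := continuous_compact cq (@segment_compact _ 0 L).
  apply: (@sq_int_bounded _ _ _ (M + 1)).
    exact: subspace_continuous_measurable_fun.
  by move=> y yI; apply: mrt; [rewrite ltrDl|exists y].
have iq := sq_int_integrable hq.
pose Q n := II (fun y => sinn n y * q y).
have csn n : continuous (sinn n) by case: n => [|n]; [move=> y; rewrite /sinn;
  exact: (c1_continuous (c1_sinl (0 * b)))|exact: continuous_sn].
have isq n : mu.-integrable `[0, L] (EFin \o (fun y => sinn n y * q y)).
  rewrite (_ : (fun y => _) = (fun y => q y * sinn n y)); last by apply/funext => y; rewrite mulrC.
  exact: integrableM_continuous.
have Q0 : Q 0%N = 0.
  rewrite /Q; under eq_Rintegral do rewrite /sinn !mul0r sin0 mul0r.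
  by rewrite Rintegral_cst// mul0r.
have Qrec n : II (fun y => sinn n.+1 y * f y) = 1 / 2 * (Q n.+2 + Q n) - cos (b * x) * Q n.+1.
  rewrite /Q -RintegralD// -!RintegralZl//; last exact: integrable_EFinD.
  rewrite -RintegralB//; [|by apply: integrable_EFinZ => //;
    exact: integrable_EFinD|exact: integrable_EFinZ].
  apply: eq_Rintegral => y; rewrite inE => yI.
  by rewrite fDq// -mulrDl sinn_rec /D; field.
(* A discrete Wronskian of [Q n] and [sinn n x]. By [Qrec] the coefficient of f is half the defect
   of Q in the recurrence that [sinn n x] satisfies, so each term of the series is half an increment
   of [A]. *)
pose A n := Q n.+1 * sinn n x - Q n * sinn n.+1 x.
have term n : II (fun y => sinn n.+1 y * f y) * sinn n.+1 x = 1 / 2 * (A n.+1 - A n).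
  have e2 : sinn n.+2 x = 2 * cos (b * x) * sinn n.+1 x - sinn n x by rewrite -sinn_rec addrK.
  by rewrite Qrec /A e2; field.
have sumA M : \sum_(0 <= n < M) II (fun y => sinn n.+1 y * f y) * sinn n.+1 x = 1 / 2 * A M.
  elim: M => [|M IH].
    by rewrite big_geq// /A Q0 mul0r subr0 /sinn !mul0r sin0 mulr0 mulr0.
  by rewrite big_nat_recr//= IH term; ring.
have coef_phi n : coef L (sn L) phi n =
    2 / L * II (fun y => sinn n.+1 y * f y) + ka * (n == 0%N)%:R.
  rewrite /coef -(sinnS n).
  have -> : II (fun y => sinn n.+1 y * phi y) =
    II (fun y => sinn n.+1 y * f y + ka * (sinn n.+1 y * sinn 1 y)).
    by apply: eq_Rintegral => y _; rewrite /f; ring.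
  have i1 : mu.-integrable `[0, L] (EFin \o (fun y => sinn n.+1 y * f y)).
    by apply: integrable_continuous => y; apply: cvgM; [exact: csn|exact: cf].
  have i2 : mu.-integrable `[0, L] (EFin \o (fun y => sinn n.+1 y * sinn 1 y)).
    by apply: integrable_continuous => y; apply: cvgM; exact: csn.
  rewrite RintegralD//; last exact: integrable_EFinZ.
  by rewrite RintegralZl// (orthogonal_sn L0 n 0); field; rewrite gt_eqF.
have Qcvg : Q n.+1 @[n --> \oo] --> 0.
  have -> : (fun n => Q n.+1) = (fun n => L / 2 * coef L (sn L) q n).
    by apply/funext => n; rewrite -coefK.
  rewrite -[X in _ --> X](mulr0 (L / 2)); apply: cvgM; first exact: cvg_cst.
  by apply: coef_cvg0 => //; [exact: continuous_sn|exact: orthogonal_sn].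
have Acvg : A n @[n --> \oo] --> 0.
  have Qc : Q n @[n --> \oo] --> 0 by rewrite -cvg_shiftS; exact: Qcvg.
  have hb (P : nat -> R) (s : nat -> R) : P n @[n --> \oo] --> 0 -> (forall n, `|s n| <= 1) ->
      P n * s n @[n --> \oo] --> 0.
    move=> hP hs; apply/norm_cvg0P.
    have hP' : `|P n| @[n --> \oo] --> 0 by apply/norm_cvg0P.
    apply: (@squeeze_cvgr _ _ _ _ (cst 0) _ _ _ _ _ hP') => //.
    + by apply: nearW => n; rewrite normr_ge0 normrM ler_piMr// hs.
    + exact: cvg_cst.
  rewrite -[X in _ --> X](subrr 0).
  by apply: cvgB; apply: hb => // n; exact: sin_max.
have e1 : phi x = 0 + ka * sinn 1 x by rewrite /ka divfK// add0r.
have h2 : (1 / L * A M + ka * sinn 1 x) @[M --> \oo] --> phi x.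
  rewrite e1; apply: cvgD; last exact: cvg_cst.
  rewrite -[X in _ --> X](mulr0 (1 / L)); apply: cvgM; first exact: cvg_cst.
  exact: Acvg.
(* The subtracted multiple of the first mode sits in the term of index 0, so the identity needs at
   least one term. *)
apply: cvg_trans h2; apply: near_eq_cvg; exists 1%N => // -[//|M] _.
rewrite /series/=.
have -> : 1 / L * A M.+1 = 2 / L * (1 / 2 * A M.+1) by field; rewrite gt_eqF.
rewrite -sumA mulr_sumr.
have -> : ka * sinn 1 x = \sum_(0 <= n < M.+1) ka * (n == 0%N)%:R * sinn n.+1 x.
  rewrite big_nat_recl// big1_seq/= ?addr0 ?mulr1// => i _.
  by rewrite mulr0 mul0r.
rewrite -big_split/=; apply: eq_bigr => n _.
by rewrite coef_phi -sinnS; ring.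
Unshelve. all: by end_near. Qed.

End PointwiseSine.

(** * Heat flow *)
Section TimeIntegrals.
Variable R : realType.
Notation mu := (@lebesgue_measure R).

(** The series describe the flow for t > 0 only; integrability is proved on the half-open interval
    and the null point is then added. *)
Lemma integrable_itv_oc_cc (a b : R) (f : R -> R) :
  mu.-integrable `]a, b] (EFin \o f) -> mu.-integrable `[a, b] (EFin \o f).
Proof.
move=> /integrableP[mf ff]; apply/integrableP; split.
  exact/emeasurable_fun_itv_obnd_cbndP.
rewrite -integral_itv_obnd_cbnd//.
by apply: measurableT_comp.
Qed.

Lemma c1_expN (k : R) : c1 (fun s => - expR (- (k * s))) (fun s => k * expR (- (k * s))).
Proof.
have ce : continuous (fun s : R => expR (- (k * s))).
  move=> s; have h : {for s, continuous (expR \o (fun s => (- k) * s))}.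
    by apply: continuous_comp; [exact: continuous_lin|exact: continuous_expR].
  rewrite (_ : (fun s => expR (- (k * s))) = (expR \o (fun s => (- k) * s)))//.
  by apply/funext => r /=; rewrite mulNr.
split => x.
  have h := @is_derive1_comp _ expR
    (fun y : R => (- k) * y) x _ _ (is_derive_expR _) (is_derive_lin (- k) x).
  have h2 := is_deriveN h.
  rewrite (_ : (fun s => _) = - (expR \o (fun y => - k * y))).
    by apply: (is_derive_eq h2); rewrite /= mulNr mulrN opprK mulrC.
  by apply/funext => s; congr (- expR _); rewrite mulNr.
by apply: cvgM; [exact: cvg_cst|exact: ce].
Qed.

Lemma continuous_expN (k : R) : continuous (fun s => expR (- (k * s))).
Proof.
move=> s; rewrite (_ : (fun s => _) = (fun s => - - expR (- (k * s)))).
  by apply: cvgN; exact: (c1_continuous (c1_expN k)).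
by apply/funext => r; rewrite opprK.
Qed.

Lemma Rintegral_exp (k t : R) : 0 <= t ->
  Rintegral mu `[0, t] (fun s => k * expR (- (k * s))) = 1 - expR (- (k * t)).
Proof.
by move=> t0; rewrite (Rintegral_c1 t0 (c1_expN k)) mulr0 oppr0 expR0 opprK addrC.
Qed.

Lemma mul_expN_le1 (y : R) : 0 <= y -> y * expR (- y) <= 1.
Proof.
move=> y0; rewrite expRN ler_pdivrMr ?expR_gt0// mul1r.
by rewrite (le_trans _ (expR_ge1Dx y))// lerDr.
Qed.

Lemma EFin_series (u : nat -> R) l : (forall n, 0 <= u n) -> series u @ \oo --> l ->
  (\sum_(n <oo) (u n)%:E)%E = l%:E.
Proof.
move=> u0 ul; rewrite -(cvg_lim _ ul)// -EFin_lim; last by apply/cvg_ex; exists l.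
by congr (limn _); apply/funext => n; rewrite /= sumEFin.
Qed.

Lemma le_nneseries (u : nat -> \bar R) (K : R) : (forall n, (0 <= u n)%E) ->
  (forall N, (\sum_(0 <= n < N) u n <= K%:E)%E) -> (\sum_(n <oo) u n < +oo)%E.
Proof.
move=> u0 uK; apply: (@le_lt_trans _ _ K%:E); last exact: ltry.
apply: lime_le; last exact: nearW.
exact: is_cvg_nneseries.
Qed.

(** Termwise integration in time down to t = 0. The dominating function [H], the sum of the absolute
    values, may blow up like 1 / s, yet it is integrable: by monotone convergence its integral is a
    sum of terms at most |d n|. *)
Lemma Rintegral_exp_series (d ka : nat -> R) (G : R -> R) (t : R) :
  asummable d -> (forall n, 0 <= ka n) -> 0 <= t ->
  (forall s : R, 0 < s <= t ->
     series (fun n => d n * (ka n * expR (- (ka n * s)))) @ \oo --> G s) ->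
  mu.-integrable `[0, t] (EFin \o G) /\
  series (fun n => d n * (1 - expR (- (ka n * t)))) @ \oo --> Rintegral mu `[0, t] G.
Proof.
move=> sd ka0 t0 hG.
pose term n (s : R) := ka n * expR (- (ka n * s)).
have term0 n s : 0 <= term n s by rewrite mulr_ge0// expR_ge0.
have cterm n : continuous (term n) by exact: (c1_expN (ka n)).2.
have sH (s : R) : 0 < s <= t -> asummable (fun n => `|d n| * term n s).
  (* As y exp (- y) <= 1 for y = ka n * s, each term is at most |d n| / s. *)
  move=> /andP[s0 _]; have s2 := @asummableZ _ s^-1 _ sd.
  apply: asummable_le s2 => n.
  rewrite !normrM normr_id mulrC ler_wpM2r// !ger0_norm ?invr_ge0 ?(ltW s0)//.
  rewrite -[leRHS]mul1r ler_pdivlMr// /term mulrAC; apply: mul_expN_le1.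
  by rewrite mulr_ge0// ltW.
pose H (s : R) := limn (series (fun n => `|d n| * term n s)).
have cvH (s : R) : 0 < s <= t -> series (fun n => `|d n| * term n s) @ \oo --> H s.
  by move=> st; apply: asummable_cvg; exact: sH.
have mI : measurable `]0, t]%classic by [].
have mHn n : measurable_fun `]0, t]%classic (fun s => `|d n| * term n s).
  apply: measurable_funM => //; apply: measurable_funTS.
  exact: continuous_measurable_fun.
have iH : mu.-integrable `]0, t] (EFin \o H).
  apply/integrableP; split.
    apply/measurable_EFinP;
      apply: (@measurable_fun_cvg _ _ _ _
      (fun N s => series (fun n => `|d n| * term n s) N)).
      by move=> N; rewrite /series/=; apply: measurable_sum.
    by move=> s; rewrite /= in_itv/= => st; exact: cvH.
  rewrite (eq_integral (fun s : measurableTypeR R => \sum_(n <oo) (`|d n| * term n s)%:E)%E); last first.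
    move=> s; rewrite inE/= in_itv/= => st.
    have hs := cvH _ st.
    rewrite (EFin_series _ hs); last by move=> n; rewrite mulr_ge0.
    rewrite /= ger0_norm// -(cvg_lim _ hs)//; apply: limr_ge; first by apply/cvg_ex; eexists; exact: hs.
    by apply: nearW => N; apply: sumr_ge0 => n _; rewrite mulr_ge0.
  rewrite integral_nneseries//; last 2 first.
    by move=> n; apply/measurable_EFinP; exact: mHn.
    by move=> n s _; rewrite lee_fin mulr_ge0.
  apply: (@le_nneseries _ (asum d)).
    by move=> n; apply: integral_ge0 => s _; rewrite lee_fin mulr_ge0.
  move=> N.
  have E n : (\int[mu]_(s in `]0%R, t]) (`|d n| * term n s)%:E
    = (`|d n| * (1 - expR (- (ka n * t))))%:E)%E.
    rewrite integral_itv_obnd_cbnd; last by apply/measurable_EFinP; exact: mHn.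
    have ci : continuous (fun s => `|d n| * term n s).
      by move=> s; apply: cvgM; [exact: cvg_cst|exact: cterm].
    rewrite -[LHS]fineK; last first.
      by apply: integrable_fin_num => //; exact: integrable_continuous.
    congr EFin; rewrite -Rintegral_exp// -RintegralZl//.
    exact: (integrable_continuous 0 t (@cterm n)).
  under eq_bigr do rewrite E.
  rewrite sumEFin lee_fin; apply: le_trans (asum_ge N sd).
  apply: ler_sum => n _; by rewrite ler_piMr// gerBl expR_ge0.
have [] := @Rintegral_dominated _ _ _ mu `]0, t] mI
   (fun N s => series (fun n => d n * term n s) N) G H.
- move=> N; rewrite /series/=; apply: measurable_sum => n.
  apply: measurable_funM => //; apply: measurable_funTS.
  exact: continuous_measurable_fun.
- by move=> s; rewrite /= in_itv/= => st; exact: hG.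
- exact: iH.
- move=> N s; rewrite /= in_itv/= => st.
  have hs := cvH _ st.
  rewrite (le_trans (ler_norm_sum _ _ _))//.
  apply: (@le_trans _ _ (series (fun n => `|d n| * term n s) N)).
    by apply: ler_sum => n _; rewrite normrM (ger0_norm (term0 _ _)).
  apply: nondecreasing_cvgn_le; last by apply/cvg_ex; eexists; exact: hs.
  by apply/nondecreasing_seqP => n; rewrite seriesSr lerDl mulr_ge0.
move=> iG cvI; split; first exact: integrable_itv_oc_cc.
rewrite -Rintegral_itv_obnd_cbnd//.
apply: cvg_trans cvI; apply: near_eq_cvg; apply: nearW => N.
have cN M : continuous (fun s => series (fun n => d n * term n s) M).
  by apply: continuous_psum => n; exact: continuousZ.
rewrite Rintegral_itv_obnd_cbnd; last first.
  apply: integrableS (integrable_continuous 0 t (@cN N)) => //.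
  exact: subset_itv_oc_cc.
have it n : mu.-integrable `[0, t] (EFin \o (fun s => term n s)).
  exact: integrable_continuous.
rewrite /series/=; elim: N => [|N IH].
  rewrite big_geq// (_ : (fun y => _) = (fun=> 0)); first by rewrite Rintegral_cst// mul0r.
  by apply/funext => y; rewrite big_geq.
rewrite big_nat_recr//= (_ : (fun y => _)
  = (fun y => \sum_(0 <= k < N) d k * term k y + d N * term N y)).
  rewrite RintegralD//; [|exact: integrable_continuous (@cN N)|exact: integrable_EFinZ].
  by rewrite IH RintegralZl// Rintegral_exp.
by apply/funext => y; rewrite big_nat_recr.
Qed.

End TimeIntegrals.

(** * Square integrability on the space-time rectangle *)

Section Rectangle.
Variables (R : realType) (L T : R).
Notation mu := (@lebesgue_measure R).

(** Tonelli, integrating in x first. The bound [g] takes extended values, so that it can be the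
    series of mode energies in the estimate of w_x. *)
Lemma L2rect_dominated (F : R -> R -> R) (g : R -> \bar R) :
  measurable_fun setT (fun p : R * R => F p.1 p.2) ->
  measurable_fun `[0, T]%classic g ->
  (forall t, 0 <= t <= T ->
     (\int[mu]_(x in `[0%R, L]) ((F x t) ^+ 2)%:E <= g t)%E) ->
  (\int[mu]_(t in `[0%R, T]) g t < +oo)%E -> L2rect L T F.
Proof.
move=> mF mg Fg goo; split => //.
have mD : measurable (cI 0 L `*` cI 0 T) by apply: measurableX; exact: measurable_itv.
have mF2 : measurable_fun setT (fun p : R * R => ((F p.1 p.2) ^+ 2)%:E).
  by apply/measurable_EFinP; exact: measurable_funX.
rewrite integral_mkcond.
set f := (X in (\int[_]_x X x < _)%E).
have mf : measurable_fun setT f.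
  by apply/(measurable_restrictT _ mD); exact: measurable_funTS.
have f0 p : (0 <= f p)%E.
  by rewrite /f patchE; case: ifP => // _; rewrite lee_fin sqr_ge0.
rewrite (fubini_tonelli2 f mf f0).
apply: (le_lt_trans _ goo); rewrite [leRHS]integral_mkcond.
have E t : (fubini_G mu f t =
   (fun t => \int[mu]_(x in `[0%R, L]) ((F x t) ^+ 2)%:E) \_ `[0%R, T]%classic t)%E.
  rewrite /fubini_G [RHS]patchE; case: ifPn => tT.
    rewrite [RHS]integral_mkcond; apply: eq_integral => x _.
    rewrite /f !patchE; congr (if _ then _ else _).
    apply/idP/idP; rewrite !inE/=; first by case.
    by move=> xL; split => //; move: tT; rewrite inE.
  rewrite -[RHS](integral0 mu setT); apply: eq_integral => x _.
  rewrite /f patchE ifF//; apply/negbTE; apply: contra tT.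
  by rewrite !inE/= => -[].
apply: ge0_le_integral => //.
- by move=> t _; apply: integral_ge0 => x _.
- exact: measurable_fun_fubini_tonelli_G.
- by apply/(measurable_restrictT _ (measurable_itv _)).
- move=> t _; rewrite E !patchE; case: ifPn => // tT.
  by apply: Fg; move: tT; rewrite inE/= in_itv.
Qed.

Lemma L2rect_bounded_slices (F : R -> R -> R) (K : R) :
  measurable_fun setT (fun p : R * R => F p.1 p.2) ->
  (forall t, 0 <= t <= T ->
     (\int[mu]_(x in `[0%R, L]) ((F x t) ^+ 2)%:E <= K%:E)%E) -> L2rect L T F.
Proof.
move=> mF FK; apply: (@L2rect_dominated _ (fun=> K%:E)) => //.
have /integrableP[_] : mu.-integrable `[0, T] (EFin \o (fun=> K)).
  by apply: integrable_continuous => x; exact: cvg_cst.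
apply: le_lt_trans; rewrite integral_cst// integral_cst//= lee_wpmul2r// lee_fin.
exact: ler_norm.
Qed.

Lemma L2rectD (F G : R -> R -> R) : L2rect L T F -> L2rect L T G ->
  L2rect L T (fun x t => F x t + G x t).
Proof.
move=> [mF fF] [mG fG]; split; first exact: measurable_funD.
have mD : measurable (cI 0 L `*` cI 0 T) by apply: measurableX; exact: measurable_itv.
apply: (@fin_sqD _ _ _ (mu \x mu)%E _ mD (fun p => F p.1 p.2) (fun p => G p.1 p.2)) => //.
- exact: measurable_funTS.
- exact: measurable_funTS.
Qed.

Lemma L2rectM (k : R -> R) (F : R -> R -> R) : continuous k -> L2rect L T F ->
  L2rect L T (fun x t => k t * F x t).
Proof.
move=> ck [mF fF].
have mk : measurable_fun setT (fun p : R * R => k p.2).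
  apply: (@measurableT_comp _ _ _ _ _ _ k); last exact: measurable_snd.
  exact: continuous_measurable_fun.
split; first exact: measurable_funM.
have mD : measurable (cI 0 L `*` cI 0 T) by apply: measurableX; exact: measurable_itv.
have [B kB] := continuous_bounded 0 T ck.
apply: (@fin_sqM _ _ _ (mu \x mu)%E _ mD B (fun p => k p.2) (fun p => F p.1 p.2)) => //.
- exact: measurable_funTS.
- exact: measurable_funTS.
- by move=> p [_ p2]; exact: kB.
Qed.

Lemma L2rect_cst (f : R -> R) : measurable_fun setT f -> sq_int_on `[0, L] f ->
  L2rect L T (fun x _ => f x).
Proof.
move=> mf [_ ff].
apply: (@L2rect_bounded_slices _ (fine (\int[mu]_(x in `[0%R, L]) (f x ^+ 2)%:E)%E)).
  by apply: (@measurableT_comp _ _ _ _ _ _ f); last exact: measurable_fst.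
move=> t _; rewrite fineK// ge0_fin_numE//; apply: integral_ge0 => x _.
by rewrite lee_fin sqr_ge0.
Qed.

Lemma integral_sq_Rintegral f : sq_int_on `[0, L] f ->
  (\int[mu]_(x in `[0%R, L]) (f x ^+ 2)%:E = (Rintegral mu `[0%R, L] (fun x => f x ^+ 2)%R)%:E)%E.
Proof.
move=> [_ ff]; rewrite fineK// ge0_fin_numE//; apply: integral_ge0 => x _.
by rewrite lee_fin sqr_ge0.
Qed.

End Rectangle.

(** * The Dirichlet heat flow as a sine series *)

Section HeatFlow.
Variables (R : realType) (L c : R) (f0 : R -> R).
Hypothesis L0 : 0 < L.
Hypothesis c0 : 0 < c.
Notation mu := (@lebesgue_measure R).
Notation II f := (Rintegral mu `[0, L] f).
Hypothesis hf0 : sq_int_on `[0, L] f0.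
Notation sn := (sn L).
Notation kn := (kn L).
Notation al := (al L).
Notation b := (coef L sn f0).

Definition rate n := c * al n ^+ 2.
Notation decay n t := (expR (- (rate n * t))).

Lemma rate_gt0 n : 0 < rate n.
Proof. by rewrite mulr_gt0// exprn_gt0// al_gt0. Qed.

Lemma asummable_inv_al2 : asummable (fun n => (al n ^+ 2)^-1).
Proof.
have h := @asummableZ _ ((pi / L) ^+ 2)^-1 _ (@asummable_inv_sq R).
apply: asummable_le h => n; rewrite le_eqVlt; apply/orP; left; apply/eqP.
by rewrite /al exprMn invfM mulrC.
Qed.

(** For fixed t > 0 the exponential absorbs the growth: exp y >= y and exp y >= y^2 / 2 at y = c
    al^2 t pay for the two terms of 1 + al^2 and leave a multiple of 1 / al^2. As the coefficients
    of f0 are bounded, this growth covers w, w_x and w_xx. *)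
Lemma asummable_decay (d : nat -> R) (B t : R) : 0 < t ->
  (forall n, `|d n| <= B * (1 + al n ^+ 2)) -> asummable (fun n => d n * decay n t).
Proof.
move=> t0 dB; have B0 : 0 <= B.
  have := le_trans (normr_ge0 _) (dB 0%N); rewrite pmulr_lge0//.
  by rewrite ltr_pwDl// sqr_ge0.
pose K := B * ((c * t)^-1 + 2 / (c * t) ^+ 2).
have h := @asummableZ _ K _ asummable_inv_al2.
apply: asummable_le h => n.
have a0 := al_gt0 L0 n; have ct0 : 0 < c * t by rewrite mulr_gt0.
have y0 : 0 < rate n * t by rewrite mulr_gt0// rate_gt0.
rewrite normrM [X in _ * X]ger0_norm ?expR_ge0// (le_trans (ler_wpM2r (expR_ge0 _) (dB n)))//.
rewrite [leRHS]ger0_norm; last first.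
  rewrite mulr_ge0 ?invr_ge0 ?sqr_ge0// /K mulr_ge0// addr_ge0 ?invr_ge0 ?(ltW ct0)//.
  by rewrite divr_ge0// sqr_ge0.
rewrite /K -[leLHS]mulrA -[leRHS]mulrA ler_wpM2l//.
rewrite expRN ler_pdivrMr ?expR_gt0//.
have h1 := expR_ge1Dx (rate n * t).
have h2 := @expR_ge1Dxn R (rate n * t) 1 (ltW y0).
have h2' : (rate n * t) ^+ 2 / 2 <= expR (rate n * t).
  by apply: le_trans h2; rewrite lerDr.
have h1' : rate n * t <= expR (rate n * t) by apply: le_trans h1; rewrite lerDr.
have -> : ((c * t)^-1 + 2 / (c * t) ^+ 2) / al n ^+ 2 * expR (rate n * t) =
    (c * t)^-1 / al n ^+ 2 * expR (rate n * t) +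
    2 / (c * t) ^+ 2 / al n ^+ 2 * expR (rate n * t) by ring.
apply: lerD.
- rewrite -invfM (_ : c * t * al n ^+ 2 = rate n * t); last by rewrite /rate; ring.
  by rewrite mulrC ler_pdivlMr// mul1r.
- have -> : 2 / (c * t) ^+ 2 / al n ^+ 2 * expR (rate n * t) =
    al n ^+ 2 * (expR (rate n * t) / ((rate n * t) ^+ 2 / 2)).
    by rewrite /rate; field; rewrite !gt_eqF.
  rewrite -[leLHS]mulr1 ler_wpM2l ?sqr_ge0// ler_pdivlMr ?mul1r//.
  by rewrite divr_gt0// exprn_gt0.
Qed.

Lemma b_bounded : exists2 B, 0 <= B & forall n, `|b n| <= B.
Proof.
have [B hB] := coef_bounded L0 (@continuous_sn R L) (orthogonal_sn L0) hf0.
by exists B => //; exact: le_trans (normr_ge0 _) (hB 0%N).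
Qed.

(** Coefficients of w, w_x, w_xx and of the time integral of w_x, in this order. The default 0 keeps
    them summable for every real t, as joint measurability on the whole plane asks. *)
Definition Aw (t : R) n := if 0 < t then b n * decay n t else 0.
Definition Ax (t : R) n := if 0 < t then b n * al n * decay n t else 0.
Definition A2 (t : R) n := if 0 < t then - (b n * al n ^+ 2) * decay n t else 0.
Definition AJ (t : R) n := if 0 <= t then b n / (c * al n) * (1 - decay n t) else 0.

Lemma asummable0 : @asummable R (fun=> 0).
Proof.
apply: (@asummable_bounded _ _ 0) => N.
by rewrite big1// => n _; rewrite normr0.
Qed.

Lemma asummable_Aw t : asummable (Aw t).
Proof.
rewrite /Aw; case: ltP => [t0|_]; last exact: asummable0.
have [B B0 hB] := b_bounded; apply: (@asummable_decay _ B) => // n.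
by rewrite (le_trans (hB n))// ler_peMr// lerDl sqr_ge0.
Qed.

Lemma asummable_Ax t : asummable (Ax t).
Proof.
rewrite /Ax; case: ltP => [t0|_]; last exact: asummable0.
have [B B0 hB] := b_bounded; apply: (@asummable_decay _ B) => // n.
rewrite normrM ler_pM// ger0_norm ?(ltW (al_gt0 L0 n))//.
have := sqr_ge0 (al n - 1); have := sqr_ge0 (al n); nra.
Qed.

Lemma asummable_A2 t : asummable (A2 t).
Proof.
rewrite /A2; case: ltP => [t0|_]; last exact: asummable0.
have [B B0 hB] := b_bounded; apply: (@asummable_decay _ B) => // n.
by rewrite normrN normrM ler_pM// ger0_norm ?sqr_ge0// lerDr.
Qed.

(** By |b y| <= b^2 + y^2 with y = 1 / al, from Bessel and the sum of 1 / al^2. Hence the time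
    integral of w_x has summable coefficients, uniformly down to t = 0. *)
Lemma asummable_bal : asummable (fun n => b n / (c * al n)).
Proof.
have s1 := asummable_coef_sq L0 (@continuous_sn R L) (orthogonal_sn L0) hf0.
have s2 := asummableD s1 asummable_inv_al2.
have s3 := @asummableZ _ c^-1 _ s2.
apply: asummable_le s3 => n; have a0 := al_gt0 L0 n.
rewrite invfM mulrCA normrM [leRHS]normrM ler_wpM2l//.
rewrite [leRHS]ger0_norm ?addr_ge0 ?invr_ge0 ?sqr_ge0//.
rewrite -exprVn; set y := (al n)^-1; rewrite ler_norml; apply/andP; split.
- by have := sqr_ge0 (b n + y); have := sqr_ge0 (b n - y); nra.
- by have := sqr_ge0 (b n + y); have := sqr_ge0 (b n - y); nra.
Qed.

Lemma decay_itv n t : 0 <= t -> 0 <= decay n t <= 1.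
Proof.
move=> t0; rewrite expR_ge0/= -expR0 ler_expR oppr_le0.
by rewrite mulr_ge0// ltW// rate_gt0.
Qed.

Lemma AJ_le t n : `|AJ t n| <= `|b n / (c * al n)|.
Proof.
rewrite /AJ; case: (leP 0 t) => [t0|_]; last by rewrite normr0.
have /andP[d0 d1] := decay_itv n t0.
by rewrite normrM ler_piMr// ger0_norm ?subr_ge0// gerBl.
Qed.

Lemma asummable_AJ t : asummable (AJ t).
Proof. by apply: asummable_le asummable_bal => n; exact: AJ_le. Qed.

Lemma measurable_decay n : measurable_fun setT (fun t => decay n t).
Proof. by apply: continuous_measurable_fun; exact: continuous_expN. Qed.

Lemma measurable_Aw n : measurable_fun setT (Aw ^~ n).
Proof.
apply: measurable_fun_ifT => //; first exact: measurable_fun_ltr.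
by apply: measurable_funM => //; exact: measurable_decay.
Qed.

Lemma measurable_Ax n : measurable_fun setT (Ax ^~ n).
Proof.
apply: measurable_fun_ifT => //; first exact: measurable_fun_ltr.
by apply: measurable_funM => //; exact: measurable_decay.
Qed.

Lemma measurable_AJ n : measurable_fun setT (AJ ^~ n).
Proof.
apply: measurable_fun_ifT => //; first exact: measurable_fun_ler.
apply: measurable_funM => //; apply: measurable_funB => //.
exact: measurable_decay.
Qed.

Let csn := @continuous_sn R L.
Let ckn := @continuous_kn R L.
Let sn1 := @sn_le1 R L.
Let kn1 := @kn_le1 R L.

(** For t <= 0 the datum itself is taken, as its sine coefficients need not be summable; restricting
    it to [0, L] makes it measurable on the line. *)
Definition heat x t := if 0 < t then fsum sn (Aw t) x else (f0 \_ `[0, L]) x.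
Definition heatx x t := fsum kn (Ax t) x.
Definition heatJ x t := fsum kn (AJ t) x.
Definition heatxx t x := fsum sn (A2 t) x.

Lemma measurable_f0 : measurable_fun setT (f0 \_ `[0, L]).
Proof. by apply/(measurable_restrictT _ (measurable_itv _)); exact: hf0.1. Qed.

Lemma measurable_heat : measurable_fun setT (fun p : R * R => heat p.1 p.2).
Proof.
apply: measurable_fun_ifT.
- by apply: measurable_fun_ltr => //; exact: measurable_snd.
- by apply: measurable_fsum2; [exact: csn|exact: sn1|exact: asummable_Aw|exact: measurable_Aw].
- apply: (@measurableT_comp _ _ _ _ _ _ (f0 \_ `[0, L])); last exact: measurable_fst.
  exact: measurable_f0.
Qed.

Lemma sq_int_heat t : sq_int_on `[0, L] (heat ^~ t).
Proof.
rewrite /heat; case: ltP => [t0|_].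
  by apply: sq_int_fsum; [exact: csn|exact: sn1|exact: asummable_Aw].
split; first by apply: measurable_funTS; exact: measurable_f0.
rewrite (eq_integral (fun x : measurableTypeR R => ((f0 x) ^+ 2)%:E)); first exact: hf0.2.
by move=> x xI; rewrite patchE xI.
Qed.

Lemma heat0 g : II (fun x => heat x 0 * g x) = II (fun x => f0 x * g x).
Proof. by apply: eq_Rintegral => x xI; rewrite /heat ltxx patchE xI. Qed.

Lemma sq_int_heatx t : sq_int_on `[0, L] (heatx ^~ t).
Proof. by apply: sq_int_fsum; [exact: ckn|exact: kn1|exact: asummable_Ax]. Qed.

Lemma sq_int_heatJ t : sq_int_on `[0, L] (heatJ ^~ t).
Proof. by apply: sq_int_fsum; [exact: ckn|exact: kn1|exact: asummable_AJ]. Qed.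

Lemma sq_int_heatxx t : sq_int_on `[0, L] (heatxx t).
Proof. by apply: sq_int_fsum; [exact: csn|exact: sn1|exact: asummable_A2]. Qed.

(** The norm of a slice never exceeds that of f0: Parseval at time t, decay of each mode, and Bessel
    for f0. *)
Lemma L2rect_heat T : L2rect L T heat.
Proof.
apply: (@L2rect_bounded_slices _ _ _ _ (II (fun x => f0 x ^+ 2))).
  exact: measurable_heat.
move=> t _; rewrite integral_sq_Rintegral; last exact: sq_int_heat.
rewrite lee_fin /heat; case: ltP => [t0|_].
  have h := Rintegral_fsum_sq L0 csn sn1 (orthogonal_sn L0) (@asummable_Aw t).
  rewrite -(@ler_pM2l _ (2 / L)) ?divr_gt0// -(cvg_lim _ h)//.
  apply: limr_le; first by apply/cvg_ex; eexists; exact: h.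
  apply: nearW => N.
  apply: le_trans (bessel L0 csn (orthogonal_sn L0) N hf0).
  apply: ler_sum => n _; rewrite /Aw t0 exprMn ler_piMr ?sqr_ge0//.
  have /andP[d0 d1] := decay_itv n (ltW t0).
  by rewrite expr_le1.
by under eq_Rintegral => x xI do rewrite patchE xI.
Qed.

Lemma L2rect_heatJ T : L2rect L T heatJ.
Proof.
pose K := asum (fun n => b n / (c * al n)).
have bd t x : `|heatJ x t| <= K.
  rewrite (le_trans (norm_fsum kn1 _ (@asummable_AJ t)))//.
  by apply: lim_series_le; [exact: asummable_AJ|exact: asummable_bal|move=> n; exact: AJ_le].
apply: (@L2rect_bounded_slices _ _ _ _ (K ^+ 2 * L)).
  by apply: measurable_fsum2; [exact: ckn|exact: kn1|exact: asummable_AJ|exact: measurable_AJ].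
move=> t _; rewrite integral_sq_Rintegral; last exact: sq_int_heatJ.
have <- : Rintegral mu `[0, L] (fun=> K ^+ 2) = K ^+ 2 * L.
  rewrite (@Rintegral_c1 _ (fun y => K ^+ 2 * y) (fun=> K ^+ 2)) ?(ltW L0)//.
    by rewrite mulr0 subr0.
  by split => x; [exact: is_derive_lin|exact: cvg_cst].
rewrite lee_fin; apply: le_Rintegral => //.
- exact: (integrable_sq_int (measurable_itv _) (sq_int_heatJ t) (sq_int_heatJ t)).
- by apply: integrable_continuous => x; exact: cvg_cst.
- by move=> x _; have := bd t x; rewrite ler_norml => /andP[? ?]; nra.
Qed.

(* The energy estimate [2 c \int_0^T \int heatx^2 <= \int f0^2], mode by mode. *)
Lemma L2rect_heatx T : 0 < T -> L2rect L T heatx.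
Proof.
move=> T0.
have mA n : measurable_fun `[0, T]%classic (fun t => L / 2 * Ax t n ^+ 2).
  apply: measurable_funM => //; apply: measurable_funX; apply: measurable_funTS.
  exact: measurable_Ax.
apply: (@L2rect_dominated _ _ _ _ (fun t => \sum_(n <oo) (L / 2 * Ax t n ^+ 2)%:E)%E).
- by apply: measurable_fsum2; [exact: ckn|exact: kn1|exact: asummable_Ax|exact: measurable_Ax].
- apply: ge0_emeasurable_sum; last by move=> n _; apply/measurable_EFinP; exact: mA.
  by move=> n t _ _; rewrite lee_fin mulr_ge0 ?sqr_ge0// divr_ge0// ltW.
- move=> t _; rewrite integral_sq_Rintegral; last exact: sq_int_heatx.
  have h := Rintegral_fsum_sq L0 ckn kn1 (orthogonal_kn L0) (@asummable_Ax t).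
  rewrite (@EFin_series _ _ (II (fun x => heatx x t ^+ 2)))//.
    by move=> n; rewrite mulr_ge0 ?sqr_ge0// divr_ge0// ltW.
  have -> : series (fun n => L / 2 * Ax t n ^+ 2) =
     (fun N => L / 2 * series (fun n => Ax t n ^+ 2) N).
    by apply/funext => N; rewrite /series/= mulr_sumr.
  have -> : II (fun x => heatx x t ^+ 2) = L / 2 * (2 / L * II (fun x => heatx x t ^+ 2)).
    by field; rewrite gt_eqF.
  by apply: cvgM; [exact: cvg_cst|exact: h].
- rewrite integral_nneseries//; last 2 first.
    by move=> n; apply/measurable_EFinP; exact: mA.
    by move=> n t _; rewrite lee_fin mulr_ge0 ?sqr_ge0// divr_ge0// ltW.
  apply: (@le_nneseries _ _ (L / 2 * ((2 * c)^-1 * (2 / L * II (fun x => f0 x ^+ 2))))).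
    move=> n; apply: integral_ge0 => t _.
    by rewrite lee_fin mulr_ge0 ?sqr_ge0// divr_ge0// ltW.
  move=> N.
  have E n : (\int[mu]_(t in `[0%R, T]) (L / 2 * Ax t n ^+ 2)%:E <=
      (L / 2 * ((2 * c)^-1 * b n ^+ 2))%:E)%E.
    (* The squared mode decays at the rate k = 2 c al^2; replacing al^2 by k / (2 c) turns it into a
       constant times k exp (- k t), whose integral is at most 1. *)
    pose k := 2 * rate n.
    have k0 : 0 < k by rewrite mulr_gt0// rate_gt0.
    have cb : 0 <= (2 * c)^-1 * b n ^+ 2.
      by apply: mulr_ge0; [rewrite invr_ge0 mulr_ge0// ltW|exact: sqr_ge0].
    pose g t := L / 2 * ((2 * c)^-1 * b n ^+ 2) * (k * expR (- (k * t))).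
    have cg : continuous g.
      by move=> t; apply: cvgM; [exact: cvg_cst|exact: (c1_expN k).2].
    apply: (@le_trans _ _ (\int[mu]_(t in `[0%R, T]) (g t)%:E)%E).
      apply: ge0_le_integral => //.
      - by move=> t _; rewrite lee_fin mulr_ge0 ?sqr_ge0// divr_ge0// ltW.
      - by apply/measurable_EFinP; exact: mA.
      - apply/measurable_EFinP; apply: measurable_funTS.
        exact: continuous_measurable_fun.
      - move=> t _; rewrite lee_fin /g -[leRHS]mulrA ler_wpM2l ?divr_ge0 ?(ltW L0)//.
        rewrite /Ax; case: ltP => t0; last first.
          rewrite expr0n/=; apply: mulr_ge0 => //.
          by apply: mulr_ge0; [exact: ltW|exact: expR_ge0].
        have -> : expR (- (k * t)) = decay n t ^+ 2.
          by rewrite expr2 -expRD; congr expR; rewrite /k; ring.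
        rewrite le_eqVlt; apply/orP; left; apply/eqP.
        by rewrite /k /rate; field; rewrite gt_eqF.
    have ig := integrable_continuous 0 T cg.
    rewrite -[leLHS]fineK; last by apply: integrable_fin_num => //.
    rewrite lee_fin -/(Rintegral mu `[0, T] g) RintegralZl//; last first.
      by apply: integrable_continuous; exact: (c1_expN k).2.
    rewrite Rintegral_exp ?(ltW T0)// ler_piMr//.
      by apply: mulr_ge0 => //; rewrite divr_ge0// ltW.
  apply: (le_trans (lee_sum _ (fun n _ => E n))).
  rewrite sumEFin lee_fin -mulr_sumr ler_wpM2l ?divr_ge0 ?(ltW L0)//.
  rewrite -mulr_sumr ler_wpM2l//; first by rewrite invr_ge0 mulr_ge0// ltW.
  exact: (bessel L0 csn (orthogonal_sn L0) N hf0).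
Qed.


Lemma cvg_seriesN (u : nat -> R) (l : R) : series u @ \oo --> l ->
  - series u N @[N --> \oo] --> - l.
Proof. by move=> h; apply: cvgN. Qed.

Lemma cvg_seriesB (u v : nat -> R) (l k : R) : series u @ \oo --> l ->
  series v @ \oo --> k -> series u N - series v N @[N --> \oo] --> l - k.
Proof. by move=> h1 h2; apply: cvgB. Qed.

Lemma continuous_integrable_c1 psi psi' : c1 psi psi' ->
  mu.-integrable `[0, L] (EFin \o psi).
Proof. by move=> hp; apply: integrable_continuous; exact: c1_continuous hp. Qed.

Lemma Rintegral_heat t g : 0 < t -> mu.-integrable `[0, L] (EFin \o g) ->
  series (fun n => b n * decay n t * II (fun x => sn n x * g x)) @ \oo -->
  II (fun x => heat x t * g x).
Proof.
move=> t0 ig; have h := Rintegral_fsum csn sn1 (@asummable_Aw t) ig.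
have -> : II (fun x => heat x t * g x) = II (fun x => fsum sn (Aw t) x * g x).
  by apply: eq_Rintegral => x _; rewrite /heat t0.
apply: cvg_trans h; apply: near_eq_cvg; apply: nearW => N.
by apply: eq_bigr => n _; rewrite /Aw t0.
Qed.

(** As psi is free at the ends, this states both that [heatx] is the derivative of w and that w
    vanishes at 0 and L. Both sides are series that agree term by term. *)
Lemma heat_heatx t psi psi' : 0 < t -> c1 psi psi' ->
  II (fun x => heat x t * psi' x) = - II (fun x => heatx x t * psi x).
Proof.
move=> t0 hp.
have h1 := Rintegral_heat t0 (integrable_continuous 0 L hp.2).
have h2 := Rintegral_fsum ckn kn1 (@asummable_Ax t) (continuous_integrable_c1 hp).
have {}h2 := cvg_seriesN h2.
rewrite -(cvg_lim _ h1)// -(cvg_lim _ h2)//; congr (limn _).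
apply/funext => N; rewrite /series/= -sumrN; apply: eq_bigr => n _.
by rewrite (int_sn_deriv L0 n hp) /Ax t0; ring.
Qed.

Lemma heatx_heatxx t phi phi' : 0 < t -> c1 phi phi' -> phi 0 = 0 -> phi L = 0 ->
  II (fun x => heatx x t * phi' x) = - II (fun x => heatxx t x * phi x).
Proof.
move=> t0 hp p0 pL.
have h1 := Rintegral_fsum ckn kn1 (@asummable_Ax t) (integrable_continuous 0 L hp.2).
have h2 := Rintegral_fsum csn sn1 (@asummable_A2 t) (continuous_integrable_c1 hp).
have {}h2 := cvg_seriesN h2.
rewrite -(cvg_lim _ h1)// -(cvg_lim _ h2)//; congr (limn _).
apply/funext => N; rewrite /series/= -sumrN; apply: eq_bigr => n _.
by rewrite (int_kn_deriv L0 n hp)// /Ax /A2 t0; ring.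
Qed.

(** The identity says that [heatJ] is the time integral of w_x. Its coefficients stay summable at t
    = 0, which carries the termwise integration over the singularity of w_x; the integrability in
    time is recorded for splitting integrals later. *)
Lemma heatJ_heat t psi psi' : 0 <= t -> c1 psi psi' ->
  mu.-integrable `[0, t] (EFin \o (fun s => II (fun x => heat x s * psi' x))) /\
  II (fun x => heatJ x t * psi x) =
  - Rintegral mu `[0, t] (fun s => II (fun x => heat x s * psi' x)).
Proof.
move=> t0 hp.
pose m n := II (fun x => kn n x * psi x).
pose d n := b n / (c * al n) * m n.
have hpsi : sq_int_on `[0, L] psi.
  by apply: sq_int_continuous; exact: c1_continuous hp.
have sd : asummable d.
  have [B hB] := coef_bounded L0 ckn (orthogonal_kn L0) hpsi.
  have h := @asummableZ _ (L / 2 * B) _ asummable_bal.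
  apply: asummable_le h => n; rewrite /d mulrC normrM [leRHS]normrM ler_wpM2r//.
  rewrite /m (coefK L0) normrM [leRHS]normrM ler_wpM2l//.
  by rewrite (le_trans (hB n))// ler_norm.
have rate0 n : 0 <= rate n by rewrite ltW// rate_gt0.
pose G s := - II (fun x => heat x s * psi' x).
have hG s : 0 < s <= t ->
    series (fun n => d n * (rate n * expR (- (rate n * s)))) @ \oo --> G s.
  move=> /andP[s0 _].
  have h := cvg_seriesN (Rintegral_heat s0 (integrable_continuous 0 L hp.2)).
  apply: cvg_trans h; apply: near_eq_cvg; apply: nearW => N.
  rewrite /series/= -sumrN; apply: eq_bigr => n _.
  rewrite (int_sn_deriv L0 n hp) /d -/(m n) /rate; field.
  by rewrite !gt_eqF ?al_gt0.
have [iG cG] := Rintegral_exp_series sd rate0 t0 hG.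
have iN : mu.-integrable `[0, t] (EFin \o (fun s => II (fun x => heat x s * psi' x))).
  have := @integrable_EFinZ _ _ _ mu _ (measurable_itv _) (-1) _ iG.
  congr (mu.-integrable _ (EFin \o _)); apply/funext => s.
  by rewrite /G mulN1r opprK.
split => //.
have -> : - Rintegral mu `[0, t] (fun s => II (fun x => heat x s * psi' x)) =
   Rintegral mu `[0, t] G.
  rewrite -mulN1r -RintegralZl//; apply: eq_Rintegral => s _.
  by rewrite mulN1r.
have h2 := Rintegral_fsum ckn kn1 (@asummable_AJ t) (continuous_integrable_c1 hp).
rewrite -(cvg_lim _ cG)// -(cvg_lim _ h2)//; congr (limn _).
apply/funext => N; apply: eq_bigr => n _.
by rewrite /AJ t0 /d -/(m n); ring.
Qed.

(** It is the test function that is expanded: two integrations by parts make its coefficients O(1 /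
    al^2), so its sine series converges absolutely, equals phi at every point of [0, L], and can be
    integrated termwise against f0. *)
Lemma parseval_sine phi phi' phi'' : c1 phi phi' -> c1 phi' phi'' ->
  phi 0 = 0 -> phi L = 0 ->
  series (fun n => b n * II (fun x => sn n x * phi x)) @ \oo -->
  II (fun x => f0 x * phi x).
Proof.
move=> hp hp' p0 pL.
pose a := coef L sn phi.
have sa : asummable a.
  have [B hB] := coef_bounded L0 csn (orthogonal_sn L0) (sq_int_continuous 0 L hp'.2).
  have h := @asummableZ _ B _ asummable_inv_al2.
  apply: asummable_le h => n; have al0 := al_gt0 L0 n.
  have -> : a n = - (al n ^+ 2)^-1 * coef L sn phi'' n.
    rewrite /a /coef (int_sn_deriv L0 n hp') (int_kn_deriv L0 n hp)//.
    by field; rewrite !gt_eqF.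
  rewrite mulrC normrM [leRHS]normrM normrN ler_wpM2r//.
  by rewrite (le_trans (hB n))// ler_norm.
have E x : `[0, L]%classic x -> fsum sn a x = phi x.
  rewrite /= in_itv/= => /andP[]; rewrite le_eqVlt => /predU1P[<- _|x0].
    rewrite p0 /fsum (_ : (fun n => _) = (fun=> 0)).
      apply: cvg_lim => //; rewrite (_ : series _ = (fun=> 0)); first exact: cvg_cst.
      by apply/funext => N; rewrite /series/= big1.
    by apply/funext => n; rewrite sn0 mulr0.
  rewrite le_eqVlt => /predU1P[->|xL].
    rewrite pL /fsum (_ : (fun n => _) = (fun=> 0)).
      apply: cvg_lim => //; rewrite (_ : series _ = (fun=> 0)); first exact: cvg_cst.
      by apply/funext => N; rewrite /series/= big1.
    by apply/funext => n; rewrite snL// mulr0.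
  apply: cvg_lim => //; apply: sine_series_pointwise => //; first exact: hp.
  by rewrite x0.
have h := Rintegral_fsum csn sn1 sa (sq_int_integrable hf0).
have -> : II (fun x => f0 x * phi x) = II (fun x => fsum sn a x * f0 x).
  by apply: eq_Rintegral => x; rewrite inE => xI; rewrite E// mulrC.
apply: cvg_trans h; apply: near_eq_cvg; apply: nearW => N.
by apply: eq_bigr => n _; rewrite /a /coef; ring.
Qed.

(** Once the time integral is expressed by [heatJ], both sides are series whose n-th term is b n
    (exp (- rate n t) - 1) times the integral of sn n against phi. *)
Lemma heat_weak t phi phi' phi'' : 0 <= t -> c1 phi phi' -> c1 phi' phi'' ->
  phi 0 = 0 -> phi L = 0 ->
  II (fun x => heat x t * phi x) - II (fun x => f0 x * phi x) =
  c * Rintegral mu `[0, t] (fun s => II (fun x => heat x s * phi'' x)).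
Proof.
move=> t0 hp hp' p0 pL.
have [-> |tn0] := eqVneq t 0.
  by rewrite heat0 subrr set_itv1 Rintegral_set1 mulr0.
have {tn0}tp : 0 < t by rewrite lt_neqAle eq_sym tn0.
(* The time integral on the right is minus the pairing of [heatJ] with phi'. *)
have [_ /eqP] := heatJ_heat t0 hp'; rewrite -eqr_oppLR => /eqP <-.
have h1 := Rintegral_heat tp (continuous_integrable_c1 hp).
have h2 := parseval_sine hp hp' p0 pL.
have h3 := Rintegral_fsum ckn kn1 (@asummable_AJ t) (integrable_continuous 0 L hp.2).
have h12 := cvg_seriesB h1 h2.
have h4 : series (fun n => AJ t n * II (fun x => kn n x * phi' x)) N * - c
    @[N --> \oo] --> II (fun x => heatJ x t * phi' x) * - c.
  by apply: cvgM; [exact: h3|exact: cvg_cst].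
rewrite [RHS](_ : _ = II (fun x => heatJ x t * phi' x) * - c); last by ring.
rewrite -(cvg_lim _ h12)// -(cvg_lim _ h4)//; congr (limn _).
apply/funext => N; rewrite /= /series/= -sumrB mulr_suml; apply: eq_bigr => n _.
rewrite (int_kn_deriv L0 n hp)// /AJ t0; field.
by rewrite !gt_eqF ?al_gt0.
Qed.

End HeatFlow.

(** * Weak derivatives on the interval *)
Section WeakDerivatives.
Variables (R : realType) (L : R).
Hypothesis L0 : 0 < L.
Notation mu := (@lebesgue_measure R).
Notation II f := (Rintegral mu `[0, L] f).

(** Serves for the piecewise function [sqpos], whose remainder is quadratic even across 0. *)
Lemma is_derive_quadratic (f : R -> R) (x d K : R) :
  (forall h, `|f (h + x) - f x - d * h| <= K * h ^+ 2) -> is_derive x 1 f d.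
Proof.
move=> hK.
have K0 : 0 <= K by have := le_trans (normr_ge0 _) (hK 1); rewrite expr1n mulr1.
have cv : h^-1 *: ((f \o shift x) (h *: (1 : R)) - f x) @[h --> 0^'] --> d.
  have -> : (fun h => h^-1 *: ((f \o shift x) (h *: (1 : R)) - f x)) =
            (fun h => h^-1 * (f (h + x) - f x)).
    by apply/funext => h; rewrite /= /GRing.scale/= mulr1.
  have c0 : K * `|h| @[h --> (0 : R)^'] --> 0.
    rewrite -[X in _ --> X](mulr0 K); apply: cvgM; first exact: cvg_cst.
    rewrite -[X in _ --> X](normr0 R); apply: cvg_norm.
    by apply: cvg_within_filter; exact: cvg_id.
  apply/subr_cvg0; apply/norm_cvg0P.
  apply: (@squeeze_cvgr _ _ _ _ (cst 0) (fun h => K * `|h|)) => //; last exact: cvg_cst.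
  near=> h; rewrite normr_ge0/=.
  have h0 : h != 0 by near: h; exact: nbhs_dnbhs_neq.
  have -> : h^-1 * (f (h + x) - f x) - d = h^-1 * (f (h + x) - f x - d * h) by field.
  rewrite normrM normfV ler_pdivrMl ?normr_gt0// (le_trans (hK h))//.
  have -> : `|h| * (K * `|h|) = K * `|h| ^+ 2 by ring.
  by rewrite real_normK// num_real.
split; first by apply/cvg_ex; exists d.
by rewrite /derive; exact: cvg_lim cv.
Unshelve. all: by end_near. Qed.

(** The squared positive part, a simple C^1 function that vanishes on a half-line. *)
Definition sqpos (y : R) := Num.max 0 y ^+ 2.

Lemma continuous_max0 : continuous (fun y : R => Num.max 0 y).
Proof. by move=> y; apply: continuous_max; [exact: cvg_cst|exact: cvg_id]. Qed.

Lemma c1_sqpos : c1 sqpos (fun y => 2 * Num.max 0 y).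
Proof.
split.
  move=> x; apply: (@is_derive_quadratic _ _ _ 1) => h; rewrite /sqpos mul1r.
  rewrite ler_norml; apply/andP; split; case: (leP 0 (h + x)) => h1; case: (leP 0 x) => h2; nra.
by move=> x; apply: cvgM; [exact: cvg_cst|exact: continuous_max0].
Qed.

Lemma c1_affine f f' (a b : R) : c1 f f' ->
  c1 (fun x => f (a * x + b)) (fun x => a * f' (a * x + b)).
Proof.
move=> [df cf].
have dl x : is_derive x (1 : R) (fun y : R => a * y + b) a.
  have h := is_deriveD (is_derive_lin a x) (is_derive_cst b x (1 : R)).
  by apply: (is_derive_eq h); rewrite addr0.
split => x.
  have h := @is_derive1_comp _ f (fun y : R => a * y + b) x _ _ (df _) (dl x).
  by apply: (is_derive_eq h); rewrite mulrC.
apply: cvgM; first exact: cvg_cst.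
have ca : {for x, continuous (fun y : R => a * y + b)}.
  by apply: cvgD; [exact: continuous_lin|exact: cvg_cst].
exact: (@continuous_comp _ _ _ (fun y : R => a * y + b) f' x ca (cf _)).
Qed.

Lemma c1V (f f' : R -> R) : (forall x, f x != 0) -> c1 f f' ->
  c1 (fun x => (f x)^-1) (fun x => - f' x / f x ^+ 2).
Proof.
move=> f0 hf; have cf := c1_continuous hf; case: hf => df cf'; split => x.
  have h := is_deriveV (f0 x) (df x).
  by apply: (is_derive_eq h); rewrite /GRing.scale/= mulrC mulrN mulNr.
apply: cvgM; first by apply: cvgN; exact: cf'.
apply: cvgV; first by rewrite expf_neq0.
by rewrite expr2; apply: cvgM; exact: cf.
Qed.

Lemma c1_lincomb f f' (a b : R) : c1 f f' ->
  c1 (fun x => a + b * f x) (fun x => b * f' x).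
Proof.
move=> [df cf]; split => x.
  have h := is_deriveD (is_derive_cst a x (1 : R)) (is_deriveZ b (df x)).
  by apply: (is_derive_eq h); rewrite add0r.
by apply: cvgM; [exact: cvg_cst|exact: cf].
Qed.

(* A C^1 cutoff that vanishes for [x <= e] and tends to 1 for [x > 0] as [e]
   tends to 0; [x * cut' e x] stays bounded uniformly in [e]. *)
Definition cut (e x : R) := 1 - e ^+ 2 * (sqpos (1 * x + - e) + e ^+ 2)^-1.
Definition cut' (e x : R) :=
  e ^+ 2 * (2 * Num.max 0 (1 * x + - e)) / (sqpos (1 * x + - e) + e ^+ 2) ^+ 2.

Lemma sqpos_ge0 y : 0 <= sqpos y. Proof. exact: sqr_ge0. Qed.

Lemma cut_den_gt0 e y : 0 < e -> 0 < sqpos y + e ^+ 2.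
Proof. by move=> e0; rewrite ltr_wpDl ?sqpos_ge0// exprn_gt0. Qed.

Lemma c1_cut e : 0 < e -> c1 (cut e) (cut' e).
Proof.
move=> e0.
have h1 := c1_affine 1 (- e) c1_sqpos.
have h2 := c1_lincomb (e ^+ 2) 1 h1.
have d0 x : e ^+ 2 + 1 * sqpos (1 * x + - e) != 0.
  by rewrite mul1r addrC gt_eqF// cut_den_gt0.
have h3 := c1V d0 h2.
have h4 := c1_lincomb 1 (- e ^+ 2) h3.
have E1 : cut e = fun x => 1 + - e ^+ 2 * (e ^+ 2 + 1 * sqpos (1 * x + - e))^-1.
  by apply/funext => x; rewrite /cut; set s := sqpos _; rewrite mul1r mulNr (addrC (e ^+ 2)).
rewrite E1; move: h4; congr c1; apply/funext => x.
rewrite /cut'; set s := sqpos _; set m := Num.max _ _.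
by rewrite !mul1r (addrC (e ^+ 2)); ring.
Qed.

Lemma cut_itv e x : 0 < e -> 0 <= cut e x <= 1.
Proof.
move=> e0; have d0 := cut_den_gt0 (1 * x + - e) e0; rewrite /cut.
apply/andP; split; first by rewrite subr_ge0 ler_pdivrMr// [leRHS]mul1r lerDr sqpos_ge0.
by rewrite gerBl divr_ge0 ?sqr_ge0// ltW.
Qed.

Lemma cut_eq0 e x : 0 < e -> x < e -> cut e x = 0.
Proof.
move=> e0 xe; rewrite /cut /sqpos mul1r max_l ?subr_le0 ?ltW//.
by rewrite expr0n/= add0r mulfV ?subrr// gt_eqF// exprn_gt0.
Qed.

(** For p = x - e >= 0 the quantity is 2 e^2 p (p + e) / (p^2 + e^2)^2. Here e^2 is at most p^2 +
    e^2 and p (p + e) at most twice that, whence 4. *)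
Lemma cut'_bound e x : 0 < e -> 0 <= x -> x * `|cut' e x| <= 4.
Proof.
move=> e0 x0; have d0 := cut_den_gt0 (1 * x + - e) e0; rewrite /cut'.
rewrite mul1r in d0 *; rewrite /sqpos in d0 *.
case: (leP 0 (x - e)) => h; last first.
  by rewrite mulr0 mulr0 mul0r normr0 mulr0.
rewrite max_r// in d0.
rewrite ger0_norm; last first.
  by rewrite divr_ge0 ?sqr_ge0// mulr_ge0 ?sqr_ge0// mulr_ge0.
rewrite mulrA ler_pdivrMr ?exprn_gt0//.
set p := x - e in h d0 *; have -> : x = p + e by rewrite /p subrK.
have q1 : e ^+ 2 <= p ^+ 2 + e ^+ 2 by rewrite lerDr sqr_ge0.
have q2 : p * (p + e) <= 2 * (p ^+ 2 + e ^+ 2) by have := sqr_ge0 (p - e); nra.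
have q3 : 0 <= p * (p + e) by rewrite mulr_ge0// addr_ge0// ltW.
have := ler_pM (sqr_ge0 e) q3 q1 q2.
set D := p ^+ 2 + e ^+ 2; nra.
Qed.

Lemma sqpos_cvg (e : nat -> R) (x : R) : e n @[n --> \oo] --> 0 ->
  sqpos (1 * x + - e n) @[n --> \oo] --> sqpos x.
Proof.
move=> he; apply: (@continuous_cvg _ _ _ _ _ (fun n => 1 * x + - e n) sqpos x).
  exact: (c1_continuous c1_sqpos).
rewrite -[X in _ --> X](subr0 x); apply: cvgB; last exact: he.
by rewrite mul1r; exact: cvg_cst.
Qed.

Lemma cut_cvg (e : nat -> R) (x : R) : 0 < x -> e n @[n --> \oo] --> 0 ->
  cut (e n) x @[n --> \oo] --> (1 : R).
Proof.
move=> x0 he.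
have e2 : e n ^+ 2 @[n --> \oo] --> 0.
  by rewrite -[X in _ --> X](mulr0 0); under eq_fun do rewrite expr2; exact: cvgM.
have p0 : sqpos x != 0 by rewrite /sqpos max_r ?ltW// expf_neq0// gt_eqF.
rewrite -[X in _ --> X](subr0 1); apply: cvgB; first exact: cvg_cst.
rewrite -[X in _ --> X](mul0r (sqpos x + 0)^-1); apply: cvgM => //.
apply: cvgV; first by rewrite addr0.
by apply: cvgD => //; exact: sqpos_cvg.
Qed.

Lemma cut'_cvg (e : nat -> R) (x : R) : 0 < x -> e n @[n --> \oo] --> 0 ->
  cut' (e n) x @[n --> \oo] --> (0 : R).
Proof.
move=> x0 he.
have e2 : e n ^+ 2 @[n --> \oo] --> 0.
  by rewrite -[X in _ --> X](mulr0 0); under eq_fun do rewrite expr2; exact: cvgM.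
have p0 : sqpos x != 0 by rewrite /sqpos max_r ?ltW// expf_neq0// gt_eqF.
rewrite -[X in _ --> X](mul0r (((sqpos x + 0) ^+ 2)^-1)); apply: cvgM; last first.
  apply: cvgV; first by rewrite addr0 expf_neq0.
  under eq_fun do rewrite expr2.
  by rewrite expr2; apply: cvgM; (apply: cvgD => //; exact: sqpos_cvg).
rewrite -[X in _ --> X](mul0r (2 * Num.max 0 x)); apply: cvgM => //.
apply: cvgM; first exact: cvg_cst.
apply: (@continuous_cvg _ _ _ _ _ (fun n => 1 * x + - e n) (fun y => Num.max 0 y) x).
  exact: continuous_max0.
rewrite -[X in _ --> X](subr0 x); apply: cvgB; last exact: he.
by rewrite mul1r; exact: cvg_cst.
Qed.

(** Linear vanishing at both ends is what compensates the derivatives of the cutoffs, which are of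
    the order of the inverse distance to the end. *)
Lemma c1_vanish_bound f f' : c1 f f' -> f 0 = 0 -> f L = 0 ->
  exists M, forall x, 0 <= x <= L -> `|f x| <= M * x /\ `|f x| <= M * (L - x).
Proof.
move=> hf f0 fL; have [B hB] := continuous_bounded 0 L hf.2.
have bd a b : 0 <= a -> a <= b -> b <= L -> `|f b - f a| <= B * (b - a).
  move=> a0 ab bL; rewrite -(Rintegral_c1 ab hf).
  have ii := integrable_continuous a b hf.2.
  rewrite (le_trans (le_normr_Rintegral _ ii))//.
  have -> : B * (b - a) = Rintegral mu `[a, b] (fun=> B).
    rewrite (@Rintegral_c1 _ (fun y => B * y) (fun=> B))//; first by ring.
    by split => x; [exact: is_derive_lin|exact: cvg_cst].
  apply: le_Rintegral => //; first exact: integrable_norm.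
    by apply: integrable_continuous => x; exact: cvg_cst.
  move=> x; rewrite /= in_itv/= => /andP[ax xb]; apply: hB.
  by rewrite /= in_itv/= (le_trans a0)//= (le_trans xb).
exists B => x /andP[x0 xL]; split.
  by have := bd 0 x (lexx _) x0 xL; rewrite f0 !subr0.
by have := bd x L x0 xL (lexx _); rewrite fL sub0r normrN.
Qed.

(** The cutoffs tend to 1 only in the open interval, so limits are taken there. *)
Lemma Rintegral_itvoo f : mu.-integrable `[0, L] (EFin \o f) ->
  II f = Rintegral mu `]0, L[ f.
Proof.
move=> hf; rewrite -Rintegral_itv_obnd_cbnd; last first.
  by apply: integrableS hf => //; exact: subset_itv_oc_cc.
rewrite -Rintegral_itv_bndo_bndc//.
by apply: integrableS hf => //; exact: subset_itv_oo_cc.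
Qed.

(** [H1] tests with functions supported inside (0, L), while the velocity equation tests with all
    phi vanishing at the ends. Multiply phi by a cutoff at each end and let the cutoffs tend to 1:
    the derivative of the product stays bounded because phi vanishes linearly, and dominated
    convergence applies. *)
Lemma weak_derivative_vanishing r r1 : sq_int_on `[0, L] r -> sq_int_on `[0, L] r1 ->
  (forall phi, test_c1 L phi ->
     II (fun x => r x * derive1 phi x) = - II (fun x => r1 x * phi x)) ->
  forall phi phi', c1 phi phi' -> phi 0 = 0 -> phi L = 0 ->
     II (fun x => r x * phi' x) = - II (fun x => r1 x * phi x).
Proof.
move=> hr hr1 H phi phi' hp p0 pL.
pose e n : R := (L / 2) * n.+2%:R^-1.
have e0 n : 0 < e n by rewrite /e mulr_gt0// divr_gt0.
have ecv : e n @[n --> \oo] --> 0.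
  rewrite -[X in _ --> X](mulr0 (L / 2)); apply: cvgM; first exact: cvg_cst.
  have h := @cvg_harmonic R; rewrite -cvg_shiftS in h; exact: h.
pose ch n x := cut (e n) x * cut (e n) (- 1 * x + L).
pose ch' n x := cut' (e n) x * cut (e n) (- 1 * x + L) + cut (e n) x * (- 1 * cut' (e n) (- 1 * x + L)).
have hch n : c1 (ch n) (ch' n).
  exact: c1M (c1_cut (e0 n)) (c1_affine _ _ (c1_cut (e0 n))).
pose ph n x := phi x * ch n x.
pose ph' n x := phi' x * ch n x + phi x * ch' n x.
have hph n : c1 (ph n) (ph' n) by exact: c1M.
have test n : test_c1 L (ph n).
  split; first by move=> x; exact: (@ex_derive _ _ _ _ _ _ _ ((hph n).1 x)).
  split; first by rewrite (c1_derive1 (hph n)); exact: (hph n).2.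
  exists (e n), (L - e n); split=> //; split; first by rewrite ltrBlDr ltrDl.
  move=> x [xe|xe]; rewrite /ph /ch; first by rewrite (cut_eq0 (e0 n) xe) mul0r mulr0.
  rewrite [cut (e n) (-1 * x + L)](cut_eq0 (e0 n)) ?mulr0//.
  by rewrite mulN1r addrC ltrBlDl -ltrBlDr.
have [M hM] := c1_vanish_bound hp p0 pL.
have [B hB] := continuous_bounded 0 L hp.2.
have [C hC] := continuous_bounded 0 L (c1_continuous hp).
have ch01 n x : 0 <= ch n x <= 1.
  have /andP[a0 a1] := cut_itv x (e0 n).
  have /andP[b0 b1] := cut_itv (- 1 * x + L) (e0 n).
  by rewrite /ch mulr_ge0//= mulr_ile1.
have xM x : 0 < x < L -> 0 <= M.
  move=> /andP[x0 xL].
  have [h _] := hM x (introT andP (conj (ltW x0) (ltW xL))).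
  by have := le_trans (normr_ge0 _) h; rewrite pmulr_lge0.
(* B bounds phi' and each of the two cutoff derivatives costs 4 M. *)
have bph' n x : 0 < x < L -> `|ph' n x| <= B + 8 * M.
  move=> xI; have M0 := xM _ xI; case/andP: xI => x0 xL.
  have xc : `[0, L]%classic x by rewrite /= in_itv/= !ltW.
  have [h1 h2] := hM x (introT andP (conj (ltW x0) (ltW xL))).
  have /andP[c0 c1] := ch01 n x.
  have /andP[a0 a1] := cut_itv x (e0 n).
  have /andP[b0 b1] := cut_itv (- 1 * x + L) (e0 n).
  rewrite (le_trans (ler_normD _ _))// lerD//.
    by rewrite normrM -[leRHS]mulr1 ler_pM// ?hB// ger0_norm.
  rewrite /ch' mulrDr (le_trans (ler_normD _ _))//.
  have -> : 8 * M = M * 4 + M * 4 by ring.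
  apply: lerD.
    rewrite mulrA normrM -[leRHS]mulr1 ler_pM//; last by rewrite ger0_norm.
    rewrite normrM (le_trans (ler_wpM2r (normr_ge0 _) h1))// -mulrA ler_wpM2l//.
    by apply: cut'_bound => //; exact: ltW.
  rewrite mulN1r mulrN mulrN normrN mulrCA normrM -[leRHS]mul1r ler_pM//.
    by rewrite ger0_norm.
  rewrite normrM (le_trans (ler_wpM2r (normr_ge0 _) h2))// -mulrA ler_wpM2l//.
  have -> : L - x = - 1 * x + L by ring.
  by apply: cut'_bound => //; rewrite mulN1r addrC subr_ge0 ltW.
have chcv (x : R) : 0 < x < L -> ch n x @[n --> \oo] --> (1 : R).
  move=> /andP[x0 xL]; rewrite -[X in _ --> X](mulr1 1).
  by apply: cvgM; apply: cut_cvg => //; rewrite mulN1r addrC subr_gt0.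
have ch'cv (x : R) : 0 < x < L -> ch' n x @[n --> \oo] --> (0 : R).
  move=> /andP[x0 xL].
  have -> : (0 : R) = 0 * 1 + 1 * (- 1 * 0) by ring.
  have y0 : 0 < - 1 * x + L by rewrite mulN1r addrC subr_gt0.
  apply: cvgD; apply: cvgM.
  + exact: cut'_cvg.
  + exact: cut_cvg.
  + exact: cut_cvg.
  + by apply: cvgM; [exact: cvg_cst|exact: cut'_cvg].
have mr : measurable_fun `]0, L[%classic r.
  by apply: measurable_funS hr.1 => //; exact: subset_itv_oo_cc.
have mr1 : measurable_fun `]0, L[%classic r1.
  by apply: measurable_funS hr1.1 => //; exact: subset_itv_oo_cc.
have ir := sq_int_integrable hr; have ir1 := sq_int_integrable hr1.
have iro : mu.-integrable `]0, L[ (EFin \o (fun x => (B + 8 * M) * `|r x|)).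
  apply: integrable_EFinZ => //; apply: integrable_norm.
  by apply: integrableS ir => //; exact: subset_itv_oo_cc.
have ir1o : mu.-integrable `]0, L[ (EFin \o (fun x => C * `|r1 x|)).
  apply: integrable_EFinZ => //; apply: integrable_norm.
  by apply: integrableS ir1 => //; exact: subset_itv_oo_cc.
have moo : measurable `]0, L[%classic by [].
have [] := @Rintegral_dominated _ _ _ mu _ moo (fun n x => r x * ph' n x)
  (fun x => r x * phi' x) _ _ _ iro.
- move=> n; apply: measurable_funM => //; apply: measurable_funTS.
  by apply: continuous_measurable_fun; exact: (hph n).2.
- move=> x; rewrite /= in_itv/= => xI; apply: cvgM; first exact: cvg_cst.
  have -> : phi' x = phi' x * 1 + phi x * 0 by ring.
  by apply: cvgD; apply: cvgM; try exact: cvg_cst; [exact: chcv|exact: ch'cv].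
- by move=> n x; rewrite /= in_itv/= => xI; rewrite normrM mulrC ler_wpM2r// bph'.
move=> _ cv1.
have [] := @Rintegral_dominated _ _ _ mu _ moo (fun n x => r1 x * ph n x)
  (fun x => r1 x * phi x) _ _ _ ir1o.
- move=> n; apply: measurable_funM => //; apply: measurable_funTS.
  by apply: continuous_measurable_fun; exact: c1_continuous (hph n).
- move=> x; rewrite /= in_itv/= => xI; apply: cvgM; first exact: cvg_cst.
  rewrite -[X in _ --> X](mulr1 (phi x)).
  by apply: cvgM; [exact: cvg_cst|exact: chcv].
- move=> n x; rewrite /= in_itv/= => /andP[x0 xL]; rewrite normrM mulrC ler_wpM2r//.
  have /andP[c0 c1] := ch01 n x.
  rewrite /ph normrM -[leRHS]mulr1 ler_pM//; last by rewrite ger0_norm.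
  by apply: hC; rewrite /= in_itv/= !ltW.
move=> _ cv2.
rewrite Rintegral_itvoo; last by apply: integrableM_continuous => //; exact: hp.2.
rewrite Rintegral_itvoo; last by apply: integrableM_continuous => //; exact: c1_continuous hp.
rewrite -(cvg_lim _ cv1)//; apply: cvg_lim => //.
rewrite (_ : (fun n => _) = (fun n => - Rintegral mu `]0, L[ (fun x => r1 x * ph n x))).
  by apply: cvgN; exact: cv2.
apply/funext => n.
rewrite -Rintegral_itvoo; last by apply: integrableM_continuous => //; exact: (hph n).2.
rewrite -Rintegral_itvoo; last by apply: integrableM_continuous => //; exact: c1_continuous (hph n).
by rewrite -(H _ (test n)) (c1_derive1 (hph n)).
Qed.

End WeakDerivatives.

(** * Primitives of integrable functions *)

Section Primitive.
Variables (R : realType) (L : R).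
Hypothesis L0 : 0 < L.
Notation mu := (@lebesgue_measure R).
Notation II f := (Rintegral mu `[0, L] f).
Variable f : R -> R.
Hypothesis fi : mu.-integrable `[0, L] (EFin \o f).

Definition prim x := Rintegral mu `[0, x] f.

Lemma continuous_prim : {within `[0, L], continuous prim}.
Proof. exact: (parameterized_integral_continuous (ltW L0) fi). Qed.

Lemma sq_int_prim : sq_int_on `[0, L] prim.
Proof.
have cq := continuous_prim.
have /compact_bounded[M [_ mrt]] := continuous_compact cq (@segment_compact _ 0 L).
apply: (@sq_int_bounded _ _ _ (M + 1)).
  exact: subspace_continuous_measurable_fun.
by move=> y yI; apply: mrt; [rewrite ltrDl|exists y].
Qed.

Lemma Rintegral_fin (D : set R) (g : R -> R) : measurable D ->
  mu.-integrable D (EFin \o g) ->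
  (\int[mu]_(x in D) (g x)%:E = (Rintegral mu D g)%:E)%E.
Proof. by move=> mD ig; rewrite fineK//; exact: integrable_fin_num. Qed.

(** Integration by parts for a merely integrable f, by Fubini on the triangle y <= x: integrating
    psi' x f y in y first produces prim x psi' x, in x first f y (psi L - psi y). *)
Lemma Rintegral_prim psi psi' : c1 psi psi' ->
  II (fun x => prim x * psi' x) = psi L * II f - II (fun x => f x * psi x).
Proof.
move=> hp.
have mI : measurable `[0, L]%classic by [].
pose fD := f \_ `[0, L].
pose pD := psi' \_ `[0, L].
have mfD : measurable_fun setT fD.
  by apply/(measurable_restrictT _ mI); case/integrableP : fi => /measurable_EFinP.
have mpD : measurable_fun setT pD.
  apply/(measurable_restrictT _ mI); apply: measurable_funTS.
  by apply: continuous_measurable_fun; exact: hp.2.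
pose k (p : R * R) := if p.2 <= p.1 then pD p.1 * fD p.2 else 0.
have mk : measurable_fun setT k.
  apply: measurable_fun_ifT => //.
    by apply: measurable_fun_ler; [exact: measurable_snd|exact: measurable_fst].
  apply: measurable_funM.
    by apply: (@measurableT_comp _ _ _ _ _ _ pD); last exact: measurable_fst.
  by apply: (@measurableT_comp _ _ _ _ _ _ fD); last exact: measurable_snd.
have mkE : measurable_fun setT (EFin \o k) by exact/measurable_EFinP.
have ifD : mu.-integrable setT (EFin \o fD).
  by rewrite -restrict_EFin; apply/integrable_restrict => //; rewrite setTI.
have ipD : mu.-integrable setT (EFin \o pD).
  rewrite -restrict_EFin; apply/integrable_restrict => //; rewrite setTI.
  by apply: integrable_continuous; exact: hp.2.
pose C := (\int[mu]_y `|(fD y)%:E|)%E.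
have Cfin : C \is a fin_num.
  by rewrite ge0_fin_numE; [case/integrableP : ifD|exact: integral_ge0].
(* The kernel is dominated by |pD x| |fD y|, a product of integrable functions of one variable. *)
have ik : (mu \x mu)%E.-integrable setT (EFin \o k).
  apply: (proj2 (@integrable12ltyP _ _ _ _ R mu mu (EFin \o k) mkE)).
  apply: (@le_lt_trans _ _ (\int[mu]_x (`|(pD x)%:E| * C))%E); last first.
    rewrite ge0_integralZr//; last exact: integral_ge0.
      by rewrite lte_mul_pinfty//; [exact: integral_ge0|
         rewrite ge0_fin_numE; [case/integrableP : ipD|exact: integral_ge0]|
         rewrite -ge0_fin_numE//; exact: integral_ge0].
    by apply: measurableT_comp => //; apply/measurable_EFinP.
  apply: ge0_le_integral => //.
  - by move=> x _; exact: integral_ge0.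
  - apply: (@measurable_fun_fubini_tonelli_F _ _ _ _ _ mu (fun p => `|(k p)%:E|)%E) => //.
    exact: measurableT_comp.
  - apply: emeasurable_funM => //.
    by apply: measurableT_comp => //; apply/measurable_EFinP.
  - move=> x _; rewrite -ge0_integralZl//; last first.
      by apply: measurableT_comp => //; apply/measurable_EFinP.
    apply: ge0_le_integral => //.
    + apply: measurableT_comp => //; apply/measurable_EFinP.
      by apply: measurableT_comp => //; exact: measurable_pair1.
    + apply: emeasurable_funM => //.
      by apply: measurableT_comp => //; apply/measurable_EFinP.
    + move=> y _; rewrite /k/=; case: ifP => _; first by rewrite normrM lee_fin.
      by rewrite normr0 lee_fin mulr_ge0.
have memE (a b z : R) : (z \in `[a, b]%classic) = (a <= z <= b).
  by apply/idP/idP; rewrite inE/= in_itv.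
pose A := II (fun x => prim x * psi' x).
have E1 : (\int[mu]_x fubini_F mu (EFin \o k) x = A%:E)%E.
  rewrite /A -Rintegral_fin//; last first.
    by apply: integrableM_continuous; [exact: sq_int_integrable sq_int_prim|exact: hp.2].
  rewrite [RHS]integral_mkcond; apply: eq_integral => x _.
  rewrite /fubini_F patchE; case: ifPn => xI; last first.
    rewrite (eq_integral (fun=> 0%E)) ?integral0// => y _.
    by rewrite /k/= /pD patchE (negbTE xI) mul0r if_same.
  have /andP[x0 xL] : 0 <= x <= L by move: xI; rewrite inE/= in_itv.
  have ix : mu.-integrable `[0, x] (EFin \o f).
    by apply: integrableS fi => //; apply: subset_itvl; rewrite bnd_simp.
  rewrite mulrC -RintegralZl// -Rintegral_fin//; last exact: integrable_EFinZ.
  rewrite [RHS]integral_mkcond; apply: eq_integral => y _.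
  rewrite /k/= /pD /fD !patchE xI !memE.
  case: (leP y x) => [yx|]; rewrite ?andbF// andbT (le_trans yx xL) andbT.
  by case: ifP => // _; rewrite mulr0.
pose B := II (fun y => psi L * f y - f y * psi y).
have E2 : (\int[mu]_y fubini_G mu (EFin \o k) y = B%:E)%E.
  have ic : mu.-integrable `[0, L] (EFin \o (fun y => f y * (psi L - psi y))).
    apply: integrableM_continuous => // x; apply: cvgB; first exact: cvg_cst.
    exact: (c1_continuous hp).
  rewrite /B; have -> : (fun y => psi L * f y - f y * psi y) = (fun y => f y * (psi L - psi y)).
    by apply/funext => y; ring.
  rewrite -Rintegral_fin//.
  rewrite [RHS]integral_mkcond; apply: eq_integral => y _.
  rewrite /fubini_G patchE; case: ifPn => yI; last first.
    rewrite (eq_integral (fun=> 0%E)) ?integral0// => x _.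
    by rewrite /k/= /fD patchE (negbTE yI) mulr0 if_same.
  have /andP[y0 yL] : 0 <= y <= L by move: yI; rewrite inE/= in_itv.
  have ip := integrable_continuous y L hp.2.
  rewrite -(Rintegral_c1 yL hp) -RintegralZl// -Rintegral_fin//; last exact: integrable_EFinZ.
  rewrite [RHS]integral_mkcond; apply: eq_integral => x _.
  rewrite /k/= /pD /fD !patchE yI !memE.
  case: (leP y x) => [yx|]//=; rewrite (le_trans y0 yx)/=.
  by case: ifP => // _; rewrite ?mul0r// mulrC.
have -> : II (fun x => prim x * psi' x) = II (fun y => psi L * f y - f y * psi y).
  by rewrite -/A -/B; apply: EFin_inj; rewrite -E1 -E2; exact: (Fubini ik).
rewrite RintegralB//; [|exact: integrable_EFinZ|].
  by rewrite RintegralZl.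
by apply: integrableM_continuous => //; exact: (c1_continuous hp).
Qed.

End Primitive.

(** * The properties of the heat flow used for control *)

Section HeatFlowInterface.
Variable R : realType.
Notation mu := (@lebesgue_measure R).

(** Hides the series from the control argument. [J] is the time integral of [wx], and [w2] is the
    second derivative of w at time T alone, the only time at which it enters a control. *)
Record heat_flow (L T c : R) (f0 : R -> R) (w wx J : R -> R -> R) (w2 : R -> R)
    : Prop := HeatFlow {
  hf_rect : [/\ L2rect L T w, L2rect L T wx & L2rect L T J] ;
  hf_slice : forall t, [/\ sq_int_on `[0, L] (w ^~ t), sq_int_on `[0, L] (wx ^~ t) &
                         sq_int_on `[0, L] (J ^~ t)] ;
  hf_w2 : measurable_fun setT w2 /\ sq_int_on `[0, L] w2 ;
  hf_wx : forall t psi psi', 0 < t -> c1 psi psi' ->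
    Rintegral mu `[0, L] (fun x => w x t * psi' x) =
    - Rintegral mu `[0, L] (fun x => wx x t * psi x) ;
  hf_J : forall t psi psi', 0 <= t -> c1 psi psi' ->
    mu.-integrable `[0, t] (EFin \o (fun s => Rintegral mu `[0, L] (fun x => w x s * psi' x))) /\
    Rintegral mu `[0, L] (fun x => J x t * psi x) =
    - Rintegral mu `[0, t] (fun s => Rintegral mu `[0, L] (fun x => w x s * psi' x)) ;
  hf_weak : forall t phi phi' phi'', 0 <= t -> c1 phi phi' -> c1 phi' phi'' ->
    phi 0 = 0 -> phi L = 0 ->
    Rintegral mu `[0, L] (fun x => w x t * phi x) -
    Rintegral mu `[0, L] (fun x => f0 x * phi x) =
    c * Rintegral mu `[0, t] (fun s => Rintegral mu `[0, L] (fun x => w x s * phi'' x)) ;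
  hf_wxx : forall phi phi', c1 phi phi' -> phi 0 = 0 -> phi L = 0 ->
    Rintegral mu `[0, L] (fun x => wx x T * phi' x) =
    - Rintegral mu `[0, L] (fun x => w2 x * phi x) }.

Lemma heat_flow_exists (L T c : R) (f0 : R -> R) : 0 < L -> 0 < T -> 0 < c ->
  sq_int_on `[0, L] f0 -> exists w wx J w2, heat_flow L T c f0 w wx J w2.
Proof.
move=> L0 T0 c0 hf0.
exists (heat L c f0), (heatx L c f0), (heatJ L c f0), (heatxx L c f0 T); split.
- by split; [exact: L2rect_heat|exact: L2rect_heatx|exact: L2rect_heatJ].
- by move=> t; split; [exact: sq_int_heat|exact: sq_int_heatx|exact: sq_int_heatJ].
- split; last exact: sq_int_heatxx.
  by apply: measurable_fsum; [exact: continuous_sn|exact: sn_le1|exact: asummable_A2].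
- by move=> *; exact: heat_heatx.
- by move=> *; exact: heatJ_heat.
- by move=> *; apply: heat_weak; eassumption.
- by move=> *; exact: heatx_heatxx.
Qed.

End HeatFlowInterface.

(** * Controlled trajectory *)
Section Pairing.
Variables (R : realType) (L : R).
Notation mu := (@lebesgue_measure R).
Notation II f := (Rintegral mu `[0, L] f).
Notation sq := (sq_int_on `[0, L]).

Lemma pair_integrable f phi : sq f -> continuous phi ->
  mu.-integrable `[0, L] (EFin \o (fun x => f x * phi x)).
Proof. by move=> hf cp; apply: integrableM_continuous => //; exact: sq_int_integrable. Qed.

(** Square integrability travels with the value, so that the pairing of a long linear combination is
    obtained by one term built from [pairingD] and [pairingZ] along its syntax. *)
Definition pairing f phi (v : R) :=
  [/\ sq f, continuous phi & II (fun x => f x * phi x) = v].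

Lemma pairing0 f phi : sq f -> continuous phi -> pairing f phi (II (fun x => f x * phi x)).
Proof. by []. Qed.

Lemma pairingD f g phi u v : pairing f phi u -> pairing g phi v ->
  pairing (fun x => f x + g x) phi (u + v).
Proof.
move=> [hf cp <-] [hg _ <-]; split => //; first exact: sq_intD.
under eq_Rintegral do rewrite mulrDl.
by rewrite RintegralD//; exact: pair_integrable.
Qed.

Lemma pairingZ k f phi u : pairing f phi u -> pairing (fun x => k * f x) phi (k * u).
Proof.
move=> [hf cp <-]; split => //; first exact: sq_intZ.
under eq_Rintegral do rewrite -mulrA.
by rewrite RintegralZl//; exact: pair_integrable.
Qed.

Lemma pairZ_integrable k f phi : sq f -> continuous phi ->
  mu.-integrable `[0, L] (EFin \o (fun x => k * f x * phi x)).
Proof. by move=> hf; apply: pair_integrable; exact: sq_intZ. Qed.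

Lemma pairZ k f phi : sq f -> continuous phi ->
  II (fun x => k * f x * phi x) = k * II (fun x => f x * phi x).
Proof. by move=> hf cp; case: (pairingZ k (pairing0 hf cp)). Qed.

(** The shape of the right-hand side of the temperature equation; [pairing4] has that of the
    velocity equation. *)
Lemma pairing3 k1 f1 p1 k2 f2 p2 f3 p3 :
  sq f1 -> continuous p1 -> sq f2 -> continuous p2 -> sq f3 -> continuous p3 ->
  II (fun x => k1 * f1 x * p1 x + k2 * f2 x * p2 x + f3 x * p3 x) =
  k1 * II (fun x => f1 x * p1 x) + k2 * II (fun x => f2 x * p2 x) +
  II (fun x => f3 x * p3 x).
Proof.
move=> h1 c1 h2 c2 h3 c3.
have i1 := pairZ_integrable k1 h1 c1; have i2 := pairZ_integrable k2 h2 c2.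
rewrite RintegralD//; [|exact: integrable_EFinD|exact: pair_integrable].
by rewrite RintegralD// !pairZ.
Qed.

Lemma pairing4 k1 f1 p1 k2 f2 p2 k3 f3 p3 f4 p4 :
  sq f1 -> continuous p1 -> sq f2 -> continuous p2 -> sq f3 -> continuous p3 ->
  sq f4 -> continuous p4 ->
  II (fun x => k1 * f1 x * p1 x + k2 * f2 x * p2 x + k3 * f3 x * p3 x + f4 x * p4 x) =
  k1 * II (fun x => f1 x * p1 x) + k2 * II (fun x => f2 x * p2 x) +
  k3 * II (fun x => f3 x * p3 x) + II (fun x => f4 x * p4 x).
Proof.
move=> h1 c1 h2 c2 h3 c3 h4 c4.
have i1 := pairZ_integrable k1 h1 c1; have i2 := pairZ_integrable k2 h2 c2.
have i3 := pairZ_integrable k3 h3 c3.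
rewrite RintegralD//; [|do 2 apply: integrable_EFinD => //|exact: pair_integrable].
by rewrite pairing3 ?pairZ//; exact: sq_intZ.
Qed.

(** The common end of the three verifications: the paired integrand is a multiple of a pairing of
    the heat flow plus the derivative of a polynomial in time. Equality is asked for s > 0 only,
    where the derivative identities of the flow hold. *)
Lemma integral_c1_perturbation (t c : R) (F W P P' : R -> R) : 0 <= t ->
  mu.-integrable `[0, t] (EFin \o W) -> c1 P P' ->
  (forall s, 0 < s <= t -> F s = c * W s + P' s) ->
  Rintegral mu `[0, t] F = c * Rintegral mu `[0, t] W + (P t - P 0).
Proof.
move=> t0 iW hP hF.
have iP := integrable_continuous 0 t hP.2.
have iS : mu.-integrable `[0, t] (EFin \o (fun s => c * W s + P' s)).
  by apply: integrable_EFinD => //; exact: integrable_EFinZ.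
rewrite -(Rintegral_c1 t0 hP) -RintegralZl// -RintegralD//; last exact: integrable_EFinZ.
have iSo : mu.-integrable `]0, t] (EFin \o (fun s => c * W s + P' s)).
  by apply: integrableS iS => //; exact: subset_itv_oc_cc.
rewrite -[RHS]Rintegral_itv_obnd_cbnd//.
rewrite -[LHS]Rintegral_itv_obnd_cbnd.
  by apply: eq_Rintegral => s; rewrite inE/= in_itv/= => st; exact: hF.
apply: eq_integrable iSo => // s; rewrite inE/= in_itv/= => st.
by rewrite hF.
Qed.

(** Provides the polynomials of the three verifications; degree 3 comes from [Gam]. *)
Lemma c1_cubic (A B C : R) :
  c1 (fun s => A * s + B * (s * s) + C * (s * (s * s)))
     (fun s => A + 2 * B * s + 3 * C * (s * s)).
Proof.
have c1id : c1 (fun s : R => s) (fun=> 1).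
  by split => s; [exact: is_derive_id|exact: cvg_cst].
have := c1M c1id (c1_lincomb A 1 (c1M c1id (c1_lincomb B C c1id))).
by congr c1; apply/funext => s; ring.
Qed.

End Pairing.

(** * The ansatz, its controls and its equations *)

Section NullControl.
Variables (R : realType) (L T rhob a Rg b nu ka : R).
Hypotheses (L0 : 0 < L) (T0 : 0 < T) (rhob0 : rhob != 0) (nu0 : 0 < nu).
Variables (rho0 r1 u0 th0 : R -> R).
Hypotheses (m_rho0 : measurable_fun setT rho0) (m_r1 : measurable_fun setT r1)
  (m_u0 : measurable_fun setT u0).
Notation mu := (@lebesgue_measure R).
Notation II f := (Rintegral mu `[0, L] f).
Notation sq := (sq_int_on `[0, L]).
Notation pairing := (pairing L).
Hypotheses (s_rho0 : sq rho0) (s_r1 : sq r1) (s_u0 : sq u0).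
Hypothesis rho0_mean : II rho0 = 0.
Hypothesis rho0_r1 : forall phi phi', c1 phi phi' -> phi 0 = 0 -> phi L = 0 ->
  II (fun x => rho0 x * phi' x) = - II (fun x => r1 x * phi x).
Variables (w wx J : R -> R -> R) (w2 : R -> R).
Hypothesis hw : heat_flow L T nu u0 w wx J w2.
Variables (q qx K : R -> R -> R) (q2 : R -> R).
Hypothesis hq : heat_flow L T ka th0 q qx K q2.

(* [gam] vanishes at 0 and T and has integral 1 over [0, T]; [gam'] is its
   derivative, [Gam] its primitive and [Ramp] the primitive of [ramp]. *)
Definition gam (t : R) := 6 / T ^+ 2 * t + - (6 / T ^+ 3) * (t * t).
Definition gam' (t : R) := 6 / T ^+ 2 + - (12 / T ^+ 3) * t.
Definition Gam (t : R) := 3 / T ^+ 2 * (t * t) + - (2 / T ^+ 3) * (t * (t * t)).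
Definition ramp (t : R) := - (T^-1) * t.
Definition Ramp (t : R) := - ((2 * T)^-1) * (t * t).

(* The coefficient of [gam] in the velocity is [Z], chosen so that the time
   integral of the velocity over [0, T] is the primitive of [rho0 / rhob]: the
   density then vanishes at time T. [Zx] and [Z2] are its weak derivatives. *)
Definition Zx x := rhob^-1 * rho0 x + ((-1) * J x T + T / 2 * wx x T).
Definition Z := prim Zx \_ `[0, L].
Definition Z2 x := rhob^-1 * r1 x + (- nu^-1 * (w x T + (-1) * u0 x) + T / 2 * w2 x).

(* [cu], [cth], [crho] are the controlled velocity, temperature and density;
   [cux], [cthx], [crhox] their weak derivatives in x; [cg], [ch] the controls. *)
Definition cu x t := w x t + (ramp t * w x T + gam t * Z x).
Definition cux x t := wx x t + (ramp t * wx x T + gam t * Zx x).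
Definition cth x t := q x t + ramp t * q x T.
Definition cthx x t := qx x t + ramp t * qx x T.
Definition crho x t :=
  rho0 x + - rhob * (J x t + (Ramp t * wx x T + Gam t * Zx x)).
Definition crhox x t :=
  r1 x + - rhob * (nu^-1 * (w x t + (-1) * u0 x) + (Ramp t * w2 x + Gam t * Z2 x)).
Definition cg x t :=
  - T^-1 * w x T + (gam' t * Z x + (- nu * ramp t * w2 x + (- nu * gam t * Z2 x +
  (a * crhox x t + Rg * cthx x t)))).
Definition ch x t :=
  - T^-1 * q x T + (- ka * ramp t * q2 x + b * cux x t).

Let mI : measurable (`[0, L]%classic : set R). Proof. by []. Qed.
Let qD f g : sq f -> sq g -> sq (fun x => f x + g x). Proof. exact: sq_intD. Qed.
Let qZ k f : sq f -> sq (fun x => k * f x). Proof. exact: sq_intZ. Qed.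
Let s_w t : sq (w ^~ t). Proof. by case: (hf_slice hw t). Qed.
Let s_wx t : sq (wx ^~ t). Proof. by case: (hf_slice hw t). Qed.
Let s_J t : sq (J ^~ t). Proof. by case: (hf_slice hw t). Qed.
Let s_w2 : sq w2. Proof. exact: (hf_w2 hw).2. Qed.
Let s_q t : sq (q ^~ t). Proof. by case: (hf_slice hq t). Qed.
Let s_qx t : sq (qx ^~ t). Proof. by case: (hf_slice hq t). Qed.
Let s_q2 : sq q2. Proof. exact: (hf_w2 hq).2. Qed.
Let s_Zx : sq Zx. Proof. by apply: qD; [exact: qZ|apply: qD; exact: qZ]. Qed.
Let s_prim : sq (prim Zx). Proof. exact: (sq_int_prim L0 (sq_int_integrable s_Zx)). Qed.

Lemma sq_int_restrict f : sq f -> sq (f \_ `[0, L]).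
Proof.
move=> hf; split.
  by apply: measurable_funTS; apply/(measurable_restrictT _ mI); exact: hf.1.
rewrite (eq_integral (fun x : measurableTypeR R => ((f x) ^+ 2)%:E)); first exact: hf.2.
by move=> x xI; rewrite patchE xI.
Qed.

Lemma Rintegral_restrict (f g : R -> R) :
  II (fun x => (f \_ `[0, L]) x * g x) = II (fun x => f x * g x).
Proof. by apply: eq_Rintegral => x xI; rewrite patchE xI. Qed.

Let s_Z : sq Z. Proof. exact: sq_int_restrict. Qed.
Let s_Z2 : sq Z2.
Proof. by apply: qD; [exact: qZ|apply: qD; apply: qZ => //; apply: qD => //; exact: qZ]. Qed.

Lemma int_one f : II (fun x => f x * 1) = II f.
Proof. by apply: eq_Rintegral => x _; rewrite mulr1. Qed.

Lemma c1_one : c1 (fun=> 1 : R) (fun=> 0 : R).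
Proof. by split => x; [exact: is_derive_cst|exact: cvg_cst]. Qed.

(** Here the zero mean of rho0 enters, and it makes Z vanish at L. Testing with the constant 1,
    whose derivative is 0, shows that J(T) and w_x(T) have mean zero. *)
Lemma Zx_mean : II Zx = 0.
Proof.
have c1c := c1_one; have cc := c1_continuous c1c.
have [_ _ E] := pairingD (pairingZ rhob^-1 (pairing0 s_rho0 cc))
  (pairingD (pairingZ (-1) (pairing0 (s_J T) cc)) (pairingZ (T / 2) (pairing0 (s_wx T) cc))).
rewrite -int_one E int_one rho0_mean mulr0 add0r.
have [_ ->] := hf_J hw (ltW T0) c1c.
have := hf_wx hw T0 c1c; under eq_Rintegral do rewrite mulr0.
rewrite Rintegral_cst// mul0r => /eqP; rewrite eq_sym oppr_eq0 => /eqP ->.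
under eq_Rintegral => s _ do (under eq_Rintegral do rewrite mulr0).
under eq_Rintegral => s _ do rewrite Rintegral_cst// mul0r.
by rewrite Rintegral_cst// mul0r oppr0 !mulr0 addr0.
Qed.

(** Z vanishes at 0 as a primitive and at L by [Zx_mean], so psi is free at the ends. *)
Lemma Z_weak psi psi' : c1 psi psi' ->
  II (fun x => Z x * psi' x) = - II (fun x => Zx x * psi x).
Proof.
move=> hp; rewrite Rintegral_restrict (Rintegral_prim L0 (sq_int_integrable s_Zx) hp).
by rewrite Zx_mean mulr0 sub0r.
Qed.

Lemma cu_pair t phi : continuous (phi : R -> R) -> pairing (cu ^~ t) phi
  (II (fun x => w x t * phi x) + (ramp t * II (fun x => w x T * phi x) +
     gam t * II (fun x => Z x * phi x))).
Proof. by move=> c; exact: (pairingD (pairing0 (s_w t) c) (pairingD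
  (pairingZ _ (pairing0 (s_w T) c)) (pairingZ _ (pairing0 s_Z c)))). Qed.

Lemma cux_pair t phi : continuous (phi : R -> R) -> pairing (cux ^~ t) phi
  (II (fun x => wx x t * phi x) + (ramp t * II (fun x => wx x T * phi x) +
     gam t * II (fun x => Zx x * phi x))).
Proof. by move=> c; exact: (pairingD (pairing0 (s_wx t) c) (pairingD
  (pairingZ _ (pairing0 (s_wx T) c)) (pairingZ _ (pairing0 s_Zx c)))). Qed.

Lemma cth_pair t phi : continuous (phi : R -> R) -> pairing (cth ^~ t) phi
  (II (fun x => q x t * phi x) + ramp t * II (fun x => q x T * phi x)).
Proof. by move=> c; exact: (pairingD (pairing0 (s_q t) c) (pairingZ _ (pairing0 (s_q T) c))). Qed.

Lemma cthx_pair t phi : continuous (phi : R -> R) -> pairing (cthx ^~ t) phi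
  (II (fun x => qx x t * phi x) + ramp t * II (fun x => qx x T * phi x)).
Proof. by move=> c; exact: (pairingD (pairing0 (s_qx t) c) (pairingZ _ (pairing0 (s_qx T) c))). Qed.

Lemma crho_pair t phi : continuous (phi : R -> R) -> pairing (crho ^~ t) phi
  (II (fun x => rho0 x * phi x) + - rhob * (II (fun x => J x t * phi x) +
     (Ramp t * II (fun x => wx x T * phi x) + Gam t * II (fun x => Zx x * phi x)))).
Proof.
by move=> c; exact: (pairingD (pairing0 s_rho0 c) (pairingZ _ (pairingD (pairing0 (s_J t) c)
  (pairingD (pairingZ _ (pairing0 (s_wx T) c)) (pairingZ _ (pairing0 s_Zx c)))))).
Qed.

Lemma crhox_pair t phi : continuous (phi : R -> R) -> pairing (crhox ^~ t) phi
  (II (fun x => r1 x * phi x) + - rhob * (nu^-1 * (II (fun x => w x t * phi x) +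
     (-1) * II (fun x => u0 x * phi x)) +
     (Ramp t * II (fun x => w2 x * phi x) + Gam t * II (fun x => Z2 x * phi x)))).
Proof.
by move=> c; exact: (pairingD (pairing0 s_r1 c) (pairingZ _ (pairingD
  (pairingZ _ (pairingD (pairing0 (s_w t) c) (pairingZ _ (pairing0 s_u0 c))))
  (pairingD (pairingZ _ (pairing0 s_w2 c)) (pairingZ _ (pairing0 s_Z2 c)))))).
Qed.

Lemma Z2_pair phi : continuous (phi : R -> R) -> pairing Z2 phi
  (rhob^-1 * II (fun x => r1 x * phi x) + (- nu^-1 * (II (fun x => w x T * phi x) +
    (-1) * II (fun x => u0 x * phi x)) + T / 2 * II (fun x => w2 x * phi x))).
Proof.
by move=> c; exact: (pairingD (pairingZ _ (pairing0 s_r1 c)) (pairingD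
  (pairingZ _ (pairingD (pairing0 (s_w T) c) (pairingZ _
    (pairing0 s_u0 c)))) (pairingZ _ (pairing0 s_w2 c)))).
Qed.

Lemma Zx_pair phi : continuous (phi : R -> R) -> pairing Zx phi
  (rhob^-1 * II (fun x => rho0 x * phi x) + ((-1) * II (fun x => J x T * phi x) +
    T / 2 * II (fun x => wx x T * phi x))).
Proof.
by move=> c; exact: (pairingD (pairingZ _ (pairing0 s_rho0 c)) (pairingD
  (pairingZ _ (pairing0 (s_J T) c)) (pairingZ _ (pairing0 (s_wx T) c)))).
Qed.

Lemma cg_pair t phi : continuous (phi : R -> R) -> pairing (cg ^~ t) phi
  (- T^-1 * II (fun x => w x T * phi x) + (gam' t * II (fun x => Z x * phi x) +
   (- nu * ramp t * II (fun x => w2 x * phi x) +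
   (- nu * gam t * II (fun x => Z2 x * phi x) +
   (a * II (fun x => crhox x t * phi x) + Rg * II (fun x => cthx x t * phi x)))))).
Proof.
move=> c; have [s1 _ _] := crhox_pair t c; have [s2 _ _] := cthx_pair t c.
exact: (pairingD (pairingZ _ (pairing0 (s_w T) c)) (pairingD (pairingZ _
  (pairing0 s_Z c)) (pairingD (pairingZ _ (pairing0 s_w2 c))
  (pairingD (pairingZ _ (pairing0 s_Z2 c)) (pairingD (pairingZ _
    (pairing0 s1 c)) (pairingZ _ (pairing0 s2 c))))))).
Qed.

Lemma ch_pair t phi : continuous (phi : R -> R) -> pairing (ch ^~ t) phi
  (- T^-1 * II (fun x => q x T * phi x) + (- ka * ramp t * II (fun x => q2 x * phi x) +
   b * II (fun x => cux x t * phi x))).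
Proof.
move=> c; have [s1 _ _] := cux_pair t c.
exact: (pairingD (pairingZ _ (pairing0 (s_q T) c)) (pairingD (pairingZ _
  (pairing0 s_q2 c)) (pairingZ _ (pairing0 s1 c)))).
Qed.

Section DirichletTest.
Variables phi phi' phi'' : R -> R.
Hypotheses (hp : c1 phi phi') (hp' : c1 phi' phi'') (p0 : phi 0 = 0) (pL : phi L = 0).

Let cp : continuous phi. Proof. exact: c1_continuous hp. Qed.
Let cp' : continuous phi'. Proof. exact: c1_continuous hp'. Qed.
Let cp'' : continuous phi''. Proof. exact: hp'.2. Qed.

(** The gain of regularity: J_x is the time integral of w_xx = w_t / nu, that is (w(t) - u0) / nu,
    which is in L^2 although w_xx is singular at t = 0. *)
Lemma J_weak t : 0 <= t -> II (fun x => J x t * phi' x) =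
  - nu^-1 * (II (fun x => w x t * phi x) - II (fun x => u0 x * phi x)).
Proof.
move=> t0; have [_ ->] := hf_J hw t0 hp'.
by rewrite (hf_weak hw t0 hp hp' p0 pL); field; rewrite gt_eqF.
Qed.

Lemma Zx_weak : II (fun x => Zx x * phi' x) = - II (fun x => Z2 x * phi x).
Proof.
have [_ _ ->] := Zx_pair cp'; have [_ _ ->] := Z2_pair cp.
rewrite (rho0_r1 hp p0 pL) (J_weak (ltW T0)) (hf_wxx hw hp p0 pL).
by ring.
Qed.

Lemma crho_weak t : 0 <= t ->
  II (fun x => crho x t * phi' x) = - II (fun x => crhox x t * phi x).
Proof.
move=> t0; have [_ _ ->] := crho_pair t cp'; have [_ _ ->] := crhox_pair t cp.
rewrite (rho0_r1 hp p0 pL) (J_weak t0) (hf_wxx hw hp p0 pL) Zx_weak.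
by ring.
Qed.

Lemma cth_weak t : 0 < t ->
  II (fun x => cth x t * phi' x) = - II (fun x => cthx x t * phi x).
Proof.
move=> t0; have [_ _ ->] := cth_pair t cp'; have [_ _ ->] := cthx_pair t cp.
by rewrite (hf_wx hq t0 hp) (hf_wx hq T0 hp); ring.
Qed.

Lemma cu_weak t : 0 < t ->
  II (fun x => cu x t * phi' x) = - II (fun x => cux x t * phi x).
Proof.
move=> t0; have [_ _ ->] := cu_pair t cp'; have [_ _ ->] := cux_pair t cp.
by rewrite (hf_wx hw t0 hp) (hf_wx hw T0 hp) (Z_weak hp); ring.
Qed.

(** [cg] is designed so that, after integration by parts, only nu w against phi'' and the time
    derivative of ramp w(T) + gam Z survive. The former is integrated by the weak heat equation, the
    latter is explicit. *)
Lemma u_equation t : 0 <= t ->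
  II (fun x => cu x t * phi x) - II (fun x => u0 x * phi x) =
  Rintegral mu `[0, t] (fun s => II (fun x =>
    nu * cu x s * phi'' x + a * crho x s * phi' x + Rg * cth x s * phi' x + cg x s * phi x)).
Proof.
move=> t0.
pose A := II (fun x => w x T * phi x); pose C := II (fun x => Z x * phi x).
pose W s := II (fun x => w x s * phi'' x).
(* The polynomial ramp A + gam C. *)
have hP := c1_cubic (- T^-1 * A + 6 / T ^+ 2 * C) (- (6 / T ^+ 3) * C) 0.
rewrite (@integral_c1_perturbation _ t nu _ W _ _ t0 (hf_J hw t0 hp').1 hP).
  have [_ _ ->] := cu_pair t cp.
  rewrite -/A -/C -(hf_weak hw t0 hp hp' p0 pL) /ramp /gam.
  by ring.
move=> s /andP[s0 _].
have [s1 _ e1] := cu_pair s cp''; have [s2 _ _] := crho_pair s cp'.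
have [s3 _ _] := cth_pair s cp'; have [s4 _ e4] := cg_pair s cp.
rewrite (pairing4 _ _ _ s1 cp'' s2 cp' s3 cp' s4 cp).
rewrite e1 e4 (crho_weak (ltW s0)) (cth_weak s0) (hf_wx hw T0 hp') (hf_wxx hw hp p0 pL).
rewrite (Z_weak hp') Zx_weak -/A -/C -/(W s) /gam' /ramp /gam.
by field; rewrite gt_eqF.
Qed.

Lemma th_equation t : 0 <= t ->
  II (fun x => cth x t * phi x) - II (fun x => th0 x * phi x) =
  Rintegral mu `[0, t] (fun s => II (fun x =>
    ka * cth x s * phi'' x + b * cu x s * phi' x + ch x s * phi x)).
Proof.
move=> t0.
pose A := II (fun x => q x T * phi x).
pose W s := II (fun x => q x s * phi'' x).
have hP := c1_cubic (- T^-1 * A) 0 0.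
rewrite (@integral_c1_perturbation _ t ka _ W _ _ t0 (hf_J hq t0 hp').1 hP).
  have [_ _ ->] := cth_pair t cp.
  rewrite -/A -(hf_weak hq t0 hp hp' p0 pL) /ramp.
  by ring.
move=> s /andP[s0 _].
have [s1 _ e1] := cth_pair s cp''; have [s2 _ _] := cu_pair s cp'.
have [s4 _ e4] := ch_pair s cp.
rewrite (pairing3 _ _ s1 cp'' s2 cp' s4 cp).
rewrite e1 e4 (cu_weak s0) (hf_wx hq T0 hp') (hf_wxx hq hp p0 pL).
rewrite -/A -/(W s) /ramp.
by ring.
Qed.

End DirichletTest.

Lemma rho_equation t psi psi' : 0 <= t -> c1 psi psi' ->
  II (fun x => crho x t * psi x) - II (fun x => rho0 x * psi x) =
  Rintegral mu `[0, t] (fun s => II (fun x => rhob * cu x s * psi' x)).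
Proof.
move=> t0 hp; have cp := c1_continuous hp; have cp' := hp.2.
pose A := II (fun x => w x T * psi' x); pose C := II (fun x => Z x * psi' x).
pose W s := II (fun x => w x s * psi' x).
(* The polynomial rhob (Ramp A + Gam C), a primitive of rhob (ramp A + gam C). *)
have hP := c1_cubic 0 (rhob * (- (2 * T)^-1 * A + 3 / T ^+ 2 * C)) (rhob * - (2 / T ^+ 3) * C).
rewrite (@integral_c1_perturbation _ t rhob _ W _ _ t0 (hf_J hw t0 hp).1 hP).
  have [_ _ ->] := crho_pair t cp.
  have [_ ->] := hf_J hw t0 hp; rewrite -/(W _).
  have <- : - A = II (fun x => wx x T * psi x) by rewrite /A (hf_wx hw T0 hp) opprK.
  have <- : - C = II (fun x => Zx x * psi x) by rewrite /C (Z_weak hp) opprK.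
  by rewrite /Ramp /Gam; ring.
move=> s /andP[s0 _]; have [s1 _ e1] := cu_pair s cp'.
under eq_Rintegral do rewrite -mulrA.
rewrite RintegralZl//; last exact: pair_integrable.
by rewrite e1 -/A -/C -/(W s) /ramp /gam; field; rewrite gt_eqF.
Qed.

(** For the density this is the equation that was solved for [Zx], as Ramp T = - T / 2 and Gam T =
    1; it therefore holds at every point. *)
Lemma controlled_final x :
  [/\ crho x T = 0, cu x T = 0 & cth x T = 0].
Proof.
have Tn0 : T != 0 by rewrite gt_eqF.
rewrite /crho /cu /cth /ramp /gam /Ramp /Gam /Zx; split; field => //.
by rewrite rhob0.
Qed.

Let cpoly (k : R -> R) A B C D :
  (forall t, k t = D + 1 * (A * t + B * (t * t) + C * (t * (t * t)))) -> continuous k.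
Proof.
move=> hk; have -> : k = fun t => D + 1 * (A * t + B * (t * t) + C * (t * (t * t))).
  exact/funext.
exact: c1_continuous (c1_lincomb D 1 (c1_cubic A B C)).
Qed.

Lemma continuous_profiles :
  [/\ continuous ramp, continuous Ramp, continuous gam, continuous gam' & continuous Gam].
Proof.
split.
- by apply: (@cpoly _ (- T^-1) 0 0 0) => t; rewrite /ramp; ring.
- by apply: (@cpoly _ 0 (- (2 * T)^-1) 0 0) => t; rewrite /Ramp; ring.
- by apply: (@cpoly _ (6 / T ^+ 2) (- (6 / T ^+ 3)) 0 0) => t; rewrite /gam; ring.
- by apply: (@cpoly _ (- (12 / T ^+ 3)) 0 0 (6 / T ^+ 2)) => t; rewrite /gam'; ring.
- by apply: (@cpoly _ 0 (3 / T ^+ 2) (- (2 / T ^+ 3)) 0) => t; rewrite /Gam; ring.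
Qed.

Lemma measurable_slice (F : R -> R -> R) t : L2rect L T F -> measurable_fun setT (F ^~ t).
Proof.
case=> mF _; have -> : F ^~ t = (fun p : R * R => F p.1 p.2) \o (pair^~ t) by [].
by apply: measurableT_comp => //; exact: measurable_pair2.
Qed.

Let L2Z k (F : R -> R -> R) : L2rect L T F -> L2rect L T (fun x t => k * F x t).
Proof. by move=> hF; apply: (@L2rectM _ _ _ (fun=> k)) => // x; exact: cvg_cst. Qed.

Let L2c (k : R -> R) f : continuous k -> measurable_fun setT f -> sq f ->
  L2rect L T (fun x t => k t * f x).
Proof.
move=> ck mf sf; apply: (@L2rectM _ _ _ k (fun x _ => f x)) => //.
exact: L2rect_cst.
Qed.

Let L2k k f : measurable_fun setT f -> sq f -> L2rect L T (fun x _ => k * f x).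
Proof. by move=> mf sf; apply: L2Z; exact: L2rect_cst. Qed.

Lemma L2rect_controlled :
  [/\ L2rect L T crho, L2rect L T cu, L2rect L T cth, L2rect L T cg & L2rect L T ch].
Proof.
have [rw rwx rJ] := hf_rect hw; have [rq rqx _] := hf_rect hq.
have [kr kR kg kg' kG] := continuous_profiles.
have mwT := measurable_slice T rw; have mwxT := measurable_slice T rwx.
have mJT := measurable_slice T rJ; have mqT := measurable_slice T rq.
have mqxT := measurable_slice T rqx; have mw2 := (hf_w2 hw).1; have mq2 := (hf_w2 hq).1.
have mZx : measurable_fun setT Zx.
  apply: measurable_funD; first exact: measurable_funM.
  by apply: measurable_funD; exact: measurable_funM.
have mZ : measurable_fun setT Z.
  by apply/(measurable_restrictT _ mI); exact: s_prim.1.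
have mZ2 : measurable_fun setT Z2.
  apply: measurable_funD; first exact: measurable_funM.
  apply: measurable_funD; apply: measurable_funM => //.
  by apply: measurable_funD => //; exact: measurable_funM.
have rux : L2rect L T cux by apply: L2rectD => //; apply: L2rectD; apply: L2c.
have rthx : L2rect L T cthx by apply: L2rectD => //; apply: L2c.
have rrhox : L2rect L T crhox.
  apply: L2rectD; first exact: L2rect_cst.
  apply: L2Z; apply: L2rectD; last by apply: L2rectD; apply: L2c.
  apply: L2Z; apply: L2rectD => //; exact: L2k.
split.
- apply: L2rectD; first exact: L2rect_cst.
  by apply: L2Z; apply: L2rectD => //; apply: L2rectD; apply: L2c.
- by apply: L2rectD => //; apply: L2rectD; apply: L2c.
- by apply: L2rectD => //; apply: L2c.
- apply: L2rectD; first exact: L2k.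
  apply: L2rectD; first exact: L2c.
  apply: L2rectD; first by apply: L2c => //; exact: continuousZ.
  apply: L2rectD; first by apply: L2c => //; exact: continuousZ.
  by apply: L2rectD; exact: L2Z.
- apply: L2rectD; first exact: L2k.
  apply: L2rectD; first by apply: L2c => //; exact: continuousZ.
  exact: L2Z.
Qed.

End NullControl.

Theorem theorem1p2 (R : realType) (L rhob thetab Rg cv kappa mu_ lambda : R) :
  0 < L -> 0 < rhob -> 0 < thetab -> 0 < Rg -> 0 < cv -> 0 < kappa ->
  0 < mu_ -> 0 <= lambda + mu_ ->
  forall (rho0 u0 theta0 : R -> R) (T : R),
    H1m L rho0 -> sq_int_on `[0, L] u0 -> sq_int_on `[0, L] theta0 ->
    0 < T ->
    exists (g h : R -> R -> R), L2rect L T g /\ L2rect L T h /\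
      exists (rho u theta : R -> R -> R),
        is_solution L T rhob thetab Rg cv kappa mu_ lambda
          rho0 u0 theta0 g h rho u theta /\
        (forall x, 0 < x < L -> [/\ rho x T = 0, u x T = 0 & theta x T = 0]).
Proof.
move=> L0 rhob0 thetab0 Rg0 cv0 kappa0 mu0 lm0 rho0 u0 th0 T.
move=> [[hrho0 [r1 [hr1 weak]]] mean] hu0 hth0 T0.
pose nu := (lambda + 2 * mu_) / rhob.
pose k := kappa / (rhob * cv).
pose a := Rg * thetab / rhob.
pose b := Rg * thetab / cv.
(* The viscosity is positive because lambda + 2 mu = (lambda + mu) + mu. *)
have nu0 : 0 < nu by rewrite divr_gt0//; lra.
have k0 : 0 < k by rewrite divr_gt0// mulr_gt0.
have rn0 : rhob != 0 by rewrite gt_eqF.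
have mI : measurable (`[0, L]%classic : set R) by [].
(* The data are measurable on [0, L] only, while [L2rect] asks for measurability on the plane;
   extension by zero changes no pairing. theta0 enters only through its heat flow, which restricts
   it itself. *)
pose rr := rho0 \_ `[0, L]; pose rr1 := r1 \_ `[0, L]; pose ur := u0 \_ `[0, L].
have hrr := sq_int_restrict hrho0; have hrr1 := sq_int_restrict hr1.
have hur := sq_int_restrict hu0.
have mr (f : R -> R) : sq_int_on `[0, L] f -> measurable_fun setT (f \_ `[0, L]).
  by move=> hf; apply/(measurable_restrictT _ mI); exact: hf.1.
have [w [wx [J [w2 hw]]]] := heat_flow_exists L0 T0 nu0 hur.
have [q [qx [K [q2 hq]]]] := heat_flow_exists L0 T0 k0 hth0.
have mean' : Rintegral (@lebesgue_measure R) `[0, L] rr = 0.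
  by rewrite -[LHS]int_one Rintegral_restrict int_one.
have weak' phi phi' : c1 phi phi' -> phi 0 = 0 -> phi L = 0 ->
  Rintegral (@lebesgue_measure R) `[0, L] (fun x => rr x * phi' x) =
  - Rintegral (@lebesgue_measure R) `[0, L] (fun x => rr1 x * phi x).
  move=> hp p0 pL; rewrite /rr /rr1 !Rintegral_restrict.
  exact: (weak_derivative_vanishing L0 hrho0 hr1 weak hp p0 pL).
have [Rr Ru Rt Rgg Rh] := L2rect_controlled rhob a Rg b L0
  (mr _ hrho0) (mr _ hr1) (mr _ hu0) hrr hrr1 hur hw hq.
eexists; eexists; split; [exact: Rgg|split; [exact: Rh|]].
exists (crho T rhob rr wx J), (cu L T rhob rr w wx J), (cth T q).
split; last by move=> x _; exact: controlled_final.
split.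
- by split; [exact: Rr|exact: Ru|exact: Rt].
(* The pairing lemmas also deliver square integrability of the slices; the constant 1 is a
   continuous function to apply them to. *)
- have c1c := c1_continuous (c1_one R).
  move=> t _; split.
  + by have [] := crho_pair rhob hrr hw t c1c.
  + by have [] := cu_pair rhob L0 hrr hw t c1c.
  + by have [] := cth_pair hq t c1c.
- move=> t psi /andP[t0 _] [dpsi cpsi].
  rewrite -(Rintegral_restrict L rho0 psi).
  exact: (rho_equation rhob L0 T0 hrr mean' hw t0 (c1_test dpsi cpsi)).
- move=> t phi /andP[t0 _] [dphi [d2phi [cphi [p0 pL]]]].
  have h2 := c1_test d2phi cphi.
  have h1 := c1_test dphi (c1_continuous h2).
  rewrite -(Rintegral_restrict L u0 phi).
  exact: (u_equation rhob a Rg L0 T0 nu0 hrr hrr1 hur mean' weak' hw hq h1 h2 p0 pL t0).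
- move=> t phi /andP[t0 _] [dphi [d2phi [cphi [p0 pL]]]].
  have h2 := c1_test d2phi cphi.
  have h1 := c1_test dphi (c1_continuous h2).
  exact: (th_equation rhob b L0 T0 hrr mean' hw hq h1 h2 p0 pL t0).
Qed.
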